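(* Let $n,l$ be positive integers, $\alpha\in\mathbb{C}$, and let $\lambda$ be a partition of $nl$ with at most $n$ parts. Let $d=K_{\lambda(l^n)}$ be the Kostka number. Then the multiplicity of the irreducible representation $\mathcal{M}_n^\lambda$ in the cyclic module $\mathcal{U}(\mathfrak{gl}_n)\cdot \det^{(\alpha)}(X)^l$ is equal to the rank of the $d\times d$ matrix $$\boldsymbol{F}^{\lambda}_{n,l}(\alpha)=\Bigl(\sum_{h\in H}\alpha^{\nu(h)}\psi^\lambda_{ij}(h)\Bigr)_{1\le i,j\le d},$$ where $\{\psi^\lambda_{ij}\}_{1\le i,j\le d}$ is the basis of the $\lambda$-component of the space $C(K\backslash\mathfrak{S}_{nl}/K)$ of $K$-biinvariant functions on $\mathfrak{S}_{nl}$ given by the matrix coefficients described in the context.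
   Context: $\mathfrak{S}_m$ is the symmetric group of degree $m$, acting on $[m]=\{1,\dots,m\}$; products are composition of maps. For $\sigma\in\mathfrak{S}_m$, $\nu(\sigma)=\sum_{i\ge1}(i-1)m_i(\sigma)$, where $m_i(\sigma)$ is the number of $i$-cycles in the disjoint cycle decomposition of $\sigma$. The convention $0^0=1$ is used. For $h\in H\subset\mathfrak{S}_{nl}$ (below), $\nu(h)$ is computed in $\mathfrak{S}_{nl}$. The $\alpha$-determinant of an $n\times n$ matrix $A=(a_{ij})$ is $\det^{(\alpha)}(A)=\sum_{\sigma\in\mathfrak{S}_n}\alpha^{\nu(\sigma)}a_{\sigma(1)1}a_{\sigma(2)2}\cdots a_{\sigma(n)n}$. Let $X=(x_{ij})_{1\le i,j\le n}$ be a matrix of indeterminates and $\mathcal{P}(\mathrm{Mat}_n)$ the complex polynomial algebra in the $x_{ij}$. It is a left module over the universal enveloping algebra $\mathcal{U}(\mathfrak{gl}_n)$ of $\mathfrak{gl}_n=\mathfrak{gl}_n(\mathbb{C})$ via $E_{ij}\cdot f(X)=\sum_{s=1}^n x_{is}\frac{\partial f(X)}{\partial x_{js}}$, where $\{E_{ij}\}$ is the standard basis of $\mathfrak{gl}_n$. The module $\mathcal{U}(\mathfrak{gl}_n)\cdot\det^{(\alpha)}(X)^l$ is the cyclic submodule of $\mathcal{P}(\mathrm{Mat}_n)$ generated by the $l$-th power of $\det^{(\alpha)}(X)$. For a partition $\lambda$ with at most $n$ parts, $\mathcal{M}_n^\lambda$ is the irreducible $\mathcal{U}(\mathfrak{gl}_n)$-module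 with highest weight $\lambda$. The subgroups $K,H$ of $\mathfrak{S}_{nl}$ are the row and column groups of the standard tableau of shape $(l^n)$ whose $(i,j)$-entry is $(i-1)l+j$, i.e. $$K=\{g\in\mathfrak{S}_{nl} : \lceil g(x)/l\rceil=\lceil x/l\rceil \text{ for all } x\in[nl]\},\qquad H=\{g\in\mathfrak{S}_{nl} : g(x)\equiv x \pmod l \text{ for all } x\in[nl]\}.$$ $K_{\lambda\mu}$ denotes the Kostka number, and $(l^n)=(l,\dots,l)$ ($n$ times). Let $\mathcal{S}^\lambda$ be the irreducible unitary right $\mathfrak{S}_{nl}$-module corresponding to $\lambda$, with $\mathfrak{S}_{nl}$-invariant inner product $\langle\cdot,\cdot\rangle$ and dimension $f^\lambda$. The subspace $(\mathcal{S}^\lambda)^K$ of $K$-invariant vectors has dimension $d=K_{\lambda(l^n)}$. Fix an orthonormal basis $\boldsymbol{e}_1^\lambda,\dots,\boldsymbol{e}_{f^\lambda}^\lambda$ of $\mathcal{S}^\lambda$ such that $\boldsymbol{e}_1^\lambda,\dots,\boldsymbol{e}_d^\lambda$ span $(\mathcal{S}^\lambda)^K$ and the remaining vectors span its orthogonal complement. Put $\psi^\lambda_{ij}(g)=\langle\boldsymbol{e}_i^\lambda\cdot g,\boldsymbol{e}_j^\lambda\rangle$ for $g\in\mathfrak{S}_{nl}$. The $\lambda$-component of $C(K\backslash\mathfrak{S}_{nl}/K)$ is the space of those $K$-biinvariant functions that are linear combinations of matrix coefficients of $\mathcal{S}^\lambda$. *)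

(* Defs.v *)
From HB Require Import structures.
From mathcomp Require Import all_boot all_order all_algebra all_fingroup.
From mathcomp Require Import complex mpoly reals.

Set Implicit Arguments.
Unset Strict Implicit.
Unset Printing Implicit Defensive.

Import Order.TTheory GRing.Theory Num.Theory.

Local Open Scope ring_scope.

(* A partition is the weakly decreasing sequence of its (positive) parts. *)
Definition is_partition (s : seq nat) (m : nat) : bool :=
  [&& sorted geq s, 0%N \notin s & sumn s == m].

(* Rows and columns are numbered from 0; column indices are bounded by
   sumn s only to make the type of cells finite. *)
Definition cell (s : seq nat) : finType :=
  {x : 'I_(size s) * 'I_(sumn s) | (x.2 < nth 0%N s x.1)%N}.

Definition semistandard (s : seq nat) (m : nat) (T : {ffun cell s -> 'I_m}) :=
  [forall a : cell s, forall b : cell s,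
    (((val a).1 == (val b).1) && ((val a).2 <= (val b).2)%N
       ==> (T a <= T b)%N)
    && (((val a).1 < (val b).1)%N && ((val a).2 == (val b).2)
       ==> (T a < T b)%N)].

Definition kostka (s mu : seq nat) : nat :=
  #|[set T : {ffun cell s -> 'I_(size mu)} | semistandard T
      & [forall k, #|[set a | T a == k]| == nth 0%N mu k]]|.

Section SymmetricGroup.

Variable m : nat.
Implicit Types g h : 'S_m.

(* MathComp's product of permutations is in diagrammatic order; mapcomp is the
   composition of maps: mapcomp g h x = g (h x). *)
Definition mapcomp g h : 'S_m := (h * g)%g.

Lemma mapcompE g h x : mapcomp g h x = g (h x).
Proof. exact: permM. Qed.

Definition cycle_mult (i : nat) g : nat :=
  #|[set c in porbits g | #|c| == i]|.

Definition nu g : nat := (\sum_(1 <= i < m.+1) (i - 1) * cycle_mult i g)%N.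

(* As permutations act on {0, ..., m - 1}, the conditions defining the row and
   column groups are shifted: ceil(x/l) becomes (x %/ l).+1. *)
Definition rect_row_group (l : nat) : {set 'S_m} :=
  [set g : 'S_m | [forall x : 'I_m, g x %/ l == x %/ l]%N].

Definition rect_col_group (l : nat) : {set 'S_m} :=
  [set g : 'S_m | [forall x : 'I_m, g x == x %[mod l]]%N].

(* Row and column groups of the tableau of shape s filled with
   0, 1, 2, ... row by row. *)
Definition row_group (s : seq nat) : {set 'S_m} :=
  [set g : 'S_m | [forall x : 'I_m, reshape_index s (g x) == reshape_index s x]].

Definition col_group (s : seq nat) : {set 'S_m} :=
  [set g : 'S_m | [forall x : 'I_m, reshape_offset s (g x) == reshape_offset s x]].

End SymmetricGroup.

Section AlphaDeterminant.

Variables (C : comNzRingType) (P : comAlgType C).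

Definition alpha_det (n : nat) (alpha : C) (A : 'M[P]_n) : P :=
  \sum_(sigma : 'S_n) alpha ^+ nu sigma *: \prod_(i < n) A (sigma i) i.

End AlphaDeterminant.

(* Left U(gl_n)-modules, through the presentation of U(gl_n) by the generators
   E_ij and the relations [E_ij, E_kl] = delta_jk E_il - delta_li E_kj. *)
Record glModule (C : fieldType) (n : nat) := GlModule {
  gl_sort :> lmodType C;
  glE : 'I_n -> 'I_n -> {linear gl_sort -> gl_sort};
  glE_bracket : forall (i j k l : 'I_n) (v : gl_sort),
    glE i j (glE k l v) - glE k l (glE i j v)
    = (j == k)%:R *: glE i l v - (l == i)%:R *: glE k j v
}.
Arguments glE {C n} _ i j.

Section GlTheory.

Variables (C : fieldType) (n : nat).
Implicit Types (L M : glModule C n).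

Definition submodule M (W : M -> Prop) : Prop :=
  [/\ W 0,
      forall (a : C) (v w : M), W v -> W w -> W (a *: v + w)
    & forall (i j : 'I_n) (v : M), W v -> W (glE M i j v)].

Definition cyclic_submodule M (v : M) : M -> Prop :=
  fun w => forall W : M -> Prop, submodule W -> W v -> W w.

Definition irreducible_submodule M (W : M -> Prop) : Prop :=
  [/\ submodule W,
      exists2 w, W w & w <> 0
    & forall U : M -> Prop, submodule U -> (forall w, U w -> W w) ->
        (forall w, U w -> w = 0) \/ (forall w, W w -> U w)].

Definition irreducible_module M : Prop :=
  irreducible_submodule (fun _ : M => True).

Definition is_highest_weight_vector M (lam : seq nat) (v : M) : Prop :=
  [/\ v <> 0,
      forall i j : 'I_n, (i < j)%N -> glE M i j v = 0
    & forall i : 'I_n, glE M i i v = (nth 0%N lam i)%:R *: v].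

Definition irreducible_of_highest_weight M (lam : seq nat) : Prop :=
  irreducible_module M /\ exists v : M, is_highest_weight_vector lam v.

Definition submodule_isog L M (W : M -> Prop) : Prop :=
  exists phi : {linear L -> M},
    [/\ injective phi,
        forall i j v, phi (glE L i j v) = glE M i j (phi v)
      & forall w, W w <-> exists v, phi v = w].

Definition direct_sum M (W : M -> Prop) (k : nat) (Ws : 'I_k -> M -> Prop) :=
  (forall w, W w <-> exists2 u : 'I_k -> M,
                       forall i, Ws i (u i) & w = \sum_i u i)
  /\ (forall u : 'I_k -> M, (forall i, Ws i (u i)) -> \sum_i u i = 0 ->
       forall i, u i = 0).

(* W is a direct sum of irreducible submodules, exactly m of which are
   isomorphic to L. *)
Definition has_multiplicity L M (W : M -> Prop) (m : nat) : Prop :=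
  exists (k : nat) (Ws : 'I_k -> M -> Prop) (A : {set 'I_k}),
    [/\ direct_sum W Ws,
        forall i, irreducible_submodule (Ws i),
        forall i, i \in A <-> submodule_isog L (Ws i)
      & #|A| = m].

End GlTheory.

Section PolynomialModule.

Variables (C : fieldType) (n : nat).

(* The indeterminate x_ij is the variable of index mxvec_index i j. *)
Definition genericX : 'M[{mpoly C[n * n]}]_n :=
  \matrix_(i, j) 'X_(mxvec_index i j).

Definition polE (i j : 'I_n) (f : {mpoly C[n * n]}) : {mpoly C[n * n]} :=
  \sum_(s < n) genericX i s * mderiv (mxvec_index j s) f.

Fact polE_is_linear i j : linear (polE i j).
Proof.
move=> a f g; rewrite /polE scaler_sumr -big_split /=; apply: eq_bigr => s _.
by rewrite linearP mulrDr scalerAr.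
Qed.

HB.instance Definition _ i j :=
  GRing.isLinear.Build C {mpoly C[n * n]} {mpoly C[n * n]} _ (polE i j)
    (polE_is_linear i j).

Lemma mderiv_genericX i s j t :
  mderiv (mxvec_index j t) (genericX i s) = ((i == j) && (s == t))%:R.
Proof.
have inj : (mxvec_index i s == mxvec_index j t) = (i == j) && (s == t).
  by rewrite /mxvec_index (inj_eq (@cast_ord_inj _ _ _)) (inj_eq enum_rank_inj).
rewrite mxE mderivX mnm1E inj; case: andP => [[/eqP-> /eqP->]|_].
  rewrite scale1r -[RHS]mpolyX0; congr 'X_[_].
  by apply/mnmP => k; rewrite mnmBE mnm0E subnn.
by rewrite scale0r.
Qed.

Lemma polE_mul i j k l f :
  polE i j (polE k l f) = (j == k)%:R *: polE i l f
    + \sum_(s < n) \sum_(t < n) genericX i s * genericX k t *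
        mderiv (mxvec_index j s) (mderiv (mxvec_index l t) f).
Proof.
rewrite {2}/polE scaler_sumr -big_split /=; apply: eq_bigr => s _.
rewrite /polE linear_sum mulr_sumr /=.
under eq_bigr => t _ do
  rewrite mderivM mderiv_genericX mulrDr [k == j]eq_sym.
rewrite big_split /= (bigD1 s) //= eqxx andbT big1 ?addr0; last first.
  by move=> t /negPf ts; rewrite ts andbF /= mul0r mulr0.
congr (_ + _); last by apply: eq_bigr => t _; rewrite mulrA.
by case: eqP => _; rewrite ?(mul1r, mul0r, mulr0, scale1r, scale0r).
Qed.

Fact polE_bracket (i j k l : 'I_n) (f : {mpoly C[n * n]}) :
  polE i j (polE k l f) - polE k l (polE i j f)
  = (j == k)%:R *: polE i l f - (l == i)%:R *: polE k j f.
Proof.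
rewrite !polE_mul opprD addrACA [X in _ + X](_ : _ = 0) ?addr0 //.
apply/eqP; rewrite subr_eq0 exchange_big /=; apply/eqP.
apply: eq_bigr => t _; apply: eq_bigr => s _.
by rewrite mderiv_comm [genericX i s * _]mulrC.
Qed.

Definition polyMat : glModule C n :=
  @GlModule C n {mpoly C[n * n]} (fun i j => polE i j) polE_bracket.

End PolynomialModule.

Section Specht.

Variables (C : fieldType) (m : nat).

(* The group algebra of 'S_m; x : groupAlg stands for \sum_g x g * g. *)
Definition groupAlg : vectType C := {ffun 'S_m -> C^o}.

Definition galg (g : 'S_m) : groupAlg := [ffun s => (s == g)%:R : C^o].

(* Right multiplication by g, i.e. galg s |-> galg (mapcomp s g). *)
Definition galg_mulr (x : groupAlg) (g : 'S_m) : groupAlg :=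
  [ffun s => (x : {ffun 'S_m -> C^o}) (mapcomp s g^-1%g)].

Lemma galg_mulrE s g : galg_mulr (galg s) g = galg (mapcomp s g).
Proof.
apply/ffunP => t; rewrite !ffunE; congr (nat_of_bool _)%:R.
by apply/eqP/eqP => [<-|->]; rewrite /mapcomp ?mulKVg ?mulKg.
Qed.

Definition young_symmetrizer (lam : seq nat) : groupAlg :=
  \sum_(p in row_group m lam) \sum_(q in col_group m lam)
    (-1) ^+ odd_perm q *: galg (mapcomp p q).

(* The right ideal generated by the Young symmetrizer. *)
Definition specht (lam : seq nat) : {vspace groupAlg} :=
  <<[seq galg_mulr (young_symmetrizer lam) g | g : 'S_m]>>%VS.

End Specht.

(* A finite-dimensional right module of 'S_m with an invariant inner product
   (linear in the first argument, conjugate-linear in the second). *)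
Record unitaryRightModule (C : numClosedFieldType) (m : nat) :=
  UnitaryRightModule {
  ur_sort :> vectType C;
  ract : 'S_m -> 'End(ur_sort);
  ur_dot : {dot ur_sort for (@Num.conj C : C -> C)};
  ract1 : ract 1%g = \1%VF;
  ract_comp : forall (g h : 'S_m) (v : ur_sort),
    ract (mapcomp g h) v = ract h (ract g v);
  ur_dot_invariant : forall (g : 'S_m) (v w : ur_sort),
    ur_dot (ract g v) (ract g w) = ur_dot v w
}.
Arguments ract {C m} _ g.
Arguments ur_dot {C m} _.

Section UnitaryRightModuleTheory.

Variables (C : numClosedFieldType) (m : nat) (S : unitaryRightModule C m).

Definition ur_irreducible : Prop :=
  fullv <> 0%VS :> {vspace S} /\
  forall U : {vspace S}, (forall g, (ract S g @: U <= U)%VS) ->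
    U = 0%VS \/ U = fullv.

Definition corresponds_to (lam : seq nat) : Prop :=
  exists phi : 'Hom(groupAlg C m, S),
    [/\ forall x g, x \in specht C m lam ->
          phi (galg_mulr x g) = ract S g (phi x),
        forall x, x \in specht C m lam -> phi x = 0 -> x = 0
      & (phi @: specht C m lam)%VS = fullv].

Definition fixed_vectors (K : {set 'S_m}) : {vspace S} :=
  (\bigcap_(g in K) fixedSpace (ract S g))%VS.

(* e is an orthonormal basis whose first d vectors span the K-invariants. *)
Definition adapted_basis (K : {set 'S_m}) (d : nat) (e : seq S) : Prop :=
  [/\ basis_of fullv e,
      orthonormal (ur_dot S) e,
      <<take d e>>%VS = fixed_vectors K
    & <<drop d e>>%VS = orthov (ur_dot S) (fixed_vectors K)].

Definition psi (e : seq S) (i j : nat) (g : 'S_m) : C :=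
  ur_dot S (ract S g e`_i) e`_j.

End UnitaryRightModuleTheory.

Definition Fmatrix (C : numClosedFieldType) (n l : nat) (alpha : C)
    (S : unitaryRightModule C (n * l)) (e : seq S) (d : nat) : 'M[C]_d :=
  \matrix_(i < d, j < d)
    \sum_(h in rect_col_group (n * l) l) alpha ^+ nu h * psi e i j h.

(* Main.v *)
Require Import Defs.
From HB Require Import structures.
From mathcomp Require Import all_boot all_order all_algebra all_fingroup.
From mathcomp Require Import complex mpoly reals.
From mathcomp Require Import boolp.

(* Let T be the N-th tensor power of C^n with N = n l, with gl_n acting on the
   left and the symmetric group permuting the factors on the right, and let
   kappa be the sum of the elements of K and Phi that of the alpha^nu(h) h, h in
   H. The map e_f |-> \prod_k x_(f k, k / l) from T to polynomials is equivariant
   and injective on K-invariant tensors; it sends w.Phi to det^(alpha)(X)^l, where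
   w = e_1^l (x) ... (x) e_n^l. As U(gl_n) acts on T through the whole commutant of
   the symmetric group, U(gl_n).w = T.kappa, so the cyclic module is isomorphic to
   T.(kappa Phi kappa).
   The multiplicity of M in a submodule of T is the dimension of its space of
   highest weight vectors of weight lam. Complete reducibility (orthogonal
   complements) shows that the highest weight vectors of T.a are those of T
   multiplied by a. The highest weight vectors of T form an irreducible right
   module, which contains the image of the Specht module under x |-> e_f.x, f k
   being the row of k; hence they are isomorphic to S. The multiplicity is thus
   the rank of kappa Phi kappa on S, which is that of F because kappa is a multiple
   of the orthogonal projection onto the K-invariants. *)

Set Implicit Arguments.
Unset Strict Implicit.
Unset Printing Implicit Defensive.

Import Order.TTheory GRing.Theory Num.Theory.

Local Open Scope ring_scope.

(** * Highest weight modules *)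

Section CyclicSubmodules.

Variables (C : fieldType) (n : nat).
Implicit Types (L M : glModule C n).

Lemma submodule_sum M (W : M -> Prop) : submodule W ->
  forall (I : Type) (r : seq I) (P : pred I) (F : I -> M),
    (forall i, P i -> W (F i)) -> W (\sum_(i <- r | P i) F i).
Proof.
move=> [W0 Wlin _] I r P F WF; apply: big_ind => // x y Wx Wy.
by rewrite -[x]scale1r; apply: Wlin.
Qed.

Lemma submodule_scale M (W : M -> Prop) (a : C) v :
  submodule W -> W v -> W (a *: v).
Proof. by move=> [W0 Wlin _] Wv; rewrite -[_ *: _]addr0; apply: Wlin. Qed.

Lemma cyclic_is_submodule M (v : M) : submodule (cyclic_submodule v).
Proof.
split=> [W [] //|a u w Wu Ww W Wsub Wv|i j u Wu W Wsub Wv].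
  by case: (Wsub) => _ Wlin _; apply: Wlin; [apply: Wu|apply: Ww].
by case: (Wsub) => _ _ WE; apply: WE; apply: Wu.
Qed.

Lemma cyclic_self M (v : M) : cyclic_submodule v v.
Proof. by move=> W. Qed.

Section Product.

Variables M1 M2 : glModule C n.

(** The componentwise action on a direct sum. Cyclic submodules of it serve as graphs of
    homomorphisms and compare the effect of one operator on two vectors. *)
Definition prodE (i j : 'I_n) (p : M1 * M2) : M1 * M2 :=
  (glE M1 i j p.1, glE M2 i j p.2).

Fact prodE_is_linear i j : linear (prodE i j).
Proof. by move=> a x y; rewrite /prodE /= !linearP. Qed.

HB.instance Definition _ i j :=
  GRing.isLinear.Build C (M1 * M2)%type (M1 * M2)%type _ (prodE i j)
    (prodE_is_linear i j).

Fact prodE_bracket (i j k l : 'I_n) (p : M1 * M2) :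
  prodE i j (prodE k l p) - prodE k l (prodE i j p)
  = (j == k)%:R *: prodE i l p - (l == i)%:R *: prodE k j p.
Proof.
rewrite /prodE /=; move: (glE_bracket i j k l p.1) (glE_bracket i j k l p.2).
by move=> e1 e2; apply: injective_projections; [exact: e1|exact: e2].
Qed.

Definition prodModule : glModule C n :=
  @GlModule C n (M1 * M2)%type (fun i j => prodE i j) prodE_bracket.

End Product.

End CyclicSubmodules.

(** * Highest weight vectors and the grading by degree *)

Section HighestWeight.

Variables (C : numFieldType) (n : nat).
Implicit Types (L M : glModule C n).

(** On a vector of weight mu this is the scalar \sum_i i mu_i. A lowering operator E_ij, j < i,
    increases it by i - j, so that one number takes the place of the order on weights. *)
Definition degop M (v : M) : M := \sum_(i < n) i%:R *: glE M i i v.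

Fact degop_is_linear M : linear (@degop M).
Proof.
move=> a u v; rewrite /degop scaler_sumr -big_split /=; apply: eq_bigr => i _.
by rewrite linearP scalerDr !scalerA mulrC.
Qed.

HB.instance Definition _ M :=
  GRing.isLinear.Build C M M _ (@degop M) (@degop_is_linear M).

Lemma degop_E M (i j : 'I_n) (v : M) :
  degop (glE M i j v) = glE M i j (degop v) + (i%:R - j%:R) *: glE M i j v.
Proof.
rewrite /degop linear_sum /= scalerBl.
under eq_bigr => k _ do
  rewrite -[glE M k k _](subrK (glE M i j (glE M k k v))) glE_bracket
          scalerDr addrC scalerBr !scalerA.
rewrite big_split /=; congr (_ + _).
  by apply: eq_bigr => k _; rewrite linearZ.
rewrite sumrB; congr (_ - _).
  rewrite (bigD1 i) //= eqxx mulr1 big1 ?addr0 // => k /negPf ->.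
  by rewrite mulr0 scale0r.
rewrite (bigD1 j) //= eqxx mulr1 big1 ?addr0 // => k /negPf.
by rewrite eq_sym => ->; rewrite mulr0 scale0r.
Qed.

(** Finite sums of eigenvectors of [degop] with eigenvalues d + 1, d + 2, ... *)
Inductive above M (d : C) : M -> Prop :=
| above0 : above d 0
| aboveD (k : nat) u z :
    degop u = (d + k.+1%:R) *: u -> above d z -> above d (u + z).

Lemma above_add M d (x y : M) : above d x -> above d y -> above d (x + y).
Proof.
elim=> [|k u z ku _ IH] ay; rewrite ?add0r // -addrA.
by apply: (aboveD ku); apply: IH.
Qed.

Lemma above_scale M d (x : M) a : above d x -> above d (a *: x).
Proof.
elim=> [|k u z ku _ IH]; first by rewrite scaler0; apply: above0.
rewrite scalerDr; apply: (aboveD (k := k)) => //.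
by rewrite linearZ /= ku !scalerA mulrC.
Qed.

Lemma above_lower M d (x : M) (i j : 'I_n) :
  (j < i)%N -> above d x -> above d (glE M i j x).
Proof.
move=> ji; elim=> [|k u z ku _ IH]; first by rewrite linear0; apply: above0.
rewrite linearD; apply: (aboveD (k := (k + (i - j))%N)) => //.
rewrite degop_E ku linearZ /= -scalerDl; congr (_ *: _).
by rewrite -addrA; congr (_ + _); rewrite -addSn natrD natrB // ltnW.
Qed.

(** The product of the [degop - (d + k)] for 1 <= k <= K. For large K it kills a given vector lying
    above d, whereas an eigenvector of eigenvalue d is only multiplied by a nonzero scalar. *)
Fixpoint degshift M (d : C) K (z : M) : M :=
  if K is K'.+1 then
    degop (degshift d K' z) - (d + K'.+1%:R) *: degshift d K' z
  else z.

Lemma degshiftD M d K (x y : M) :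
  degshift d K (x + y) = degshift d K x + degshift d K y.
Proof.
elim: K => //= K ->; rewrite linearD scalerDr opprD; exact: addrACA.
Qed.

Lemma degshift_eigen M d mu K (u : M) : degop u = mu *: u ->
  degshift d K u = (\prod_(k < K) (mu - (d + k.+1%:R))) *: u.
Proof.
move=> muu; elim: K => [|K IH] /=; first by rewrite big_ord0 scale1r.
rewrite IH big_ord_recr /= linearZ /= muu !scalerA -scalerBl; congr (_ *: _).
by rewrite mulrBr; congr (_ - _); rewrite mulrC.
Qed.

(* Eigenvectors for distinct eigenvalues are independent. *)
Lemma above_eigen M d (z : M) : above d z -> degop z = d *: z -> z = 0.
Proof.
move=> az dz.
have [K K0] : exists K, forall K', (K <= K')%N -> degshift d K' z = 0.
  elim: az => [|k u w ku _ [K IH]].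
    by exists 0%N => K' _; rewrite (@degshift_eigen _ d 0 K' 0) ?scaler0 // linear0.
  exists (maxn k.+1 K) => K'; rewrite geq_max => /andP[kK KK].
  rewrite degshiftD IH // addr0 (degshift_eigen _ _ ku).
  by rewrite (bigD1 (Ordinal kK)) //= subrr mul0r scale0r.
move: (leqnn K) => /K0; rewrite (degshift_eigen _ _ dz) => /eqP.
rewrite scaler_eq0 => /orP[|/eqP //]; rewrite prodf_seq_eq0 => /hasP[k _ /=].
by rewrite opprD addrA subrr add0r oppr_eq0 pnatr_eq0.
Qed.

Definition hwdeg (lam : seq nat) : C := \sum_(i < n) i%:R * (nth 0%N lam i)%:R.

Lemma hwv_degop M lam (v : M) :
  is_highest_weight_vector lam v -> degop v = hwdeg lam *: v.
Proof.
case=> _ _ wt; rewrite /degop /hwdeg scaler_suml; apply: eq_bigr => i _.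
by rewrite wt scalerA.
Qed.

Inductive lowspan M (v : M) : M -> Prop :=
| low_refl : lowspan v v
| low_lin a u w : lowspan v u -> lowspan v w -> lowspan v (a *: u + w)
| low_E (i j : 'I_n) u : (j < i)%N -> lowspan v u -> lowspan v (glE M i j u).

Lemma low0 M (v : M) : lowspan v 0.
Proof. by rewrite -(addNr v) -scaleN1r; apply: low_lin; apply: low_refl. Qed.

Lemma lowZ M (v : M) a u : lowspan v u -> lowspan v (a *: u).
Proof. by move=> vu; rewrite -[_ *: _]addr0; apply: low_lin => //; apply: low0. Qed.

(** Half of the triangular decomposition: lowering operators alone generate the cyclic module of a
    highest weight vector. E_ij is commuted past the outermost lowering operator, and the bracket
    consists of single E's applied to a shorter expression. *)
Lemma lowspan_E M lam (v u : M) (i j : 'I_n) :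
  is_highest_weight_vector lam v -> lowspan v u -> lowspan v (glE M i j u).
Proof.
move=> [_ rais wt] vu; elim: vu i j => [i j|a x y _ IHx _ IHy i j|k l x lk vx IH i j].
- case: (ltngtP i j) => [ij|ij|/val_inj ->].
  + by rewrite rais //; apply: low0.
  + by apply: low_E => //; apply: low_refl.
  + by rewrite wt; apply: lowZ; apply: low_refl.
- by rewrite linearP; apply: low_lin.
- rewrite -[glE M i j _](subrK (glE M k l (glE M i j x))) glE_bracket -addrA.
  rewrite -scaleNr; apply: low_lin; first exact: IH.
  by apply: low_lin; [apply: IH|apply: low_E => //; apply: IH].
Qed.

(** Every lowering operator increases the degree strictly, so only a multiple of v can remain in the
    degree of v. *)
Lemma cyclic_decomp M lam (v w : M) : is_highest_weight_vector lam v ->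
  cyclic_submodule v w -> exists c, above (hwdeg lam) (w - c *: v).
Proof.
move=> hv /(_ (lowspan v)) low.
have {low}: lowspan v w.
  apply: low; last exact: low_refl.
  by split; [exact: low0|exact: low_lin|move=> i j u; exact: lowspan_E hv].
elim=> [|a x y _ [c xc] _ [c' yc]|i j u ji _ [c uc]].
- by exists 1; rewrite scale1r subrr; apply: above0.
- exists (a * c + c').
  rewrite scalerDl -scalerA opprD addrACA -scalerBr.
  by apply: above_add => //; apply: above_scale.
(* The multiple of v contained in u is itself moved up by i - j, so nothing is left in the degree of
   v. *)
- exists 0; rewrite scale0r subr0.
  rewrite -(subrK (c *: v) u) linearD; apply: above_add.
    exact: above_lower.
  rewrite linearZ /= -[_ *: _]addr0.
  apply: (aboveD (k := (i - j).-1)); last exact: above0.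
  rewrite linearZ /= degop_E (hwv_degop hv) linearZ /= -scalerDl !scalerA.
  congr (_ *: _); rewrite mulrC; congr (_ * _); congr (_ + _).
  by rewrite prednK ?subn_gt0 // natrB // ltnW.
Qed.

(** By irreducibility v generates W, so w - c v lies above the degree of v for some c; being
    homogeneous of that very degree, it vanishes. *)
Lemma hwv_unique M lam (W : M -> Prop) (v w : M) :
  irreducible_submodule W -> W v -> W w ->
  is_highest_weight_vector lam v -> is_highest_weight_vector lam w ->
  exists c, w = c *: v.
Proof.
move=> [Wsub _ Wirr] Wv Ww hv hw.
have cW : forall u, cyclic_submodule v u -> W u by move=> u; apply.
have [c0|Wc] := Wirr _ (cyclic_is_submodule v) cW.
  by case: hv => /(_ (c0 _ (@cyclic_self _ _ _ v))).
have [c cP] := cyclic_decomp hv (Wc _ Ww); exists c.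
apply/eqP; rewrite -subr_eq0; apply/eqP; apply: above_eigen cP _.
by rewrite linearB linearZ /= !(hwv_degop hv, hwv_degop hw) scalerBr !scalerA mulrC.
Qed.

Lemma degop_fst M1 M2 (p : prodModule M1 M2) : (degop p).1 = degop p.1.
Proof. exact: (linear_sum (@fst M1 M2)). Qed.

Lemma degop_snd M1 M2 (p : prodModule M1 M2) : (degop p).2 = degop p.2.
Proof. exact: (linear_sum (@snd M1 M2)). Qed.

Lemma above_fst M1 M2 d (p : prodModule M1 M2) : above d p -> above d p.1.
Proof.
elim=> [|k u z ku _ IH]; first exact: above0.
by apply: (aboveD (k := k)) => //; rewrite -degop_fst ku.
Qed.

Lemma above_snd M1 M2 d (p : prodModule M1 M2) : above d p -> above d p.2.
Proof.
elim=> [|k u z ku _ IH]; first exact: above0.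
by apply: (aboveD (k := k)) => //; rewrite -degop_snd ku.
Qed.

Lemma hwv_pair M1 M2 lam (v : M1) (w : M2) :
  is_highest_weight_vector lam v -> is_highest_weight_vector lam w ->
  is_highest_weight_vector (M := prodModule M1 M2) lam (v, w).
Proof.
move=> [v0 vr vw] [_ wr ww]; split; first by case.
- by move=> i j ij; rewrite /= /prodE /= vr // wr.
- by move=> i; rewrite /= /prodE /= vw ww.
Qed.

(** The pair is itself a highest weight vector, which is why the same scalar c serves both
    components. *)
Lemma pair_decomp M1 M2 lam (v : M1) (w : M2) (p : prodModule M1 M2) :
  is_highest_weight_vector lam v -> is_highest_weight_vector lam w ->
  cyclic_submodule ((v, w) : prodModule M1 M2) p ->
  exists c, above (hwdeg lam) (p.1 - c *: v) /\ above (hwdeg lam) (p.2 - c *: w).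
Proof.
move=> hv hw /(cyclic_decomp (hwv_pair hv hw)) [c ac]; exists c.
by split; [apply: above_fst ac|apply: above_snd ac].
Qed.

Lemma above_line M lam (v : M) c : is_highest_weight_vector lam v ->
  above (hwdeg lam) (c *: v) -> c = 0.
Proof.
move=> hv /above_eigen H; have /eqP : c *: v = 0.
  by apply: H; rewrite linearZ /= (hwv_degop hv) !scalerA mulrC.
by rewrite scaler_eq0 => /orP[/eqP //|/eqP v0]; case: hv.
Qed.

(* The submodule of M * M' generated by the pair of highest weight vectors is
   the graph of an isomorphism. *)
Lemma hw_isog M M' lam (v : M) (W : M' -> Prop) (w : M') :
  irreducible_module M -> is_highest_weight_vector lam v ->
  irreducible_submodule W -> W w -> is_highest_weight_vector lam w ->
  submodule_isog M W.
Proof.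
move=> [_ _ Mirr] hv [Wsub _ Wirr] Ww hw.
pose N : M -> M' -> Prop := fun x y =>
  cyclic_submodule ((v, w) : prodModule M M') (x, y).
have Nlin a x y x' y' : N x y -> N x' y' -> N (a *: x + x') (a *: y + y').
  by case: (cyclic_is_submodule ((v, w) : prodModule M M')) => _ H _; apply: H.
have NE i j x y : N x y -> N (glE M i j x) (glE M' i j y).
  by case: (cyclic_is_submodule ((v, w) : prodModule M M')) => _ _ H; apply: H.
have N0 : N 0 0.
  by case: (cyclic_is_submodule ((v, w) : prodModule M M')).
have Nvw : N v w by apply: (@cyclic_self _ _ (prodModule M M')).
have NW x y : N x y -> W y.
  move=> /(_ (fun p => W p.2)); apply=> //.
  case: Wsub => W0 Wlin WE; split=> //= [a [? ?] [? ?]|i j [? ?]] /=.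
    exact: Wlin.
  exact: WE.
have v0 : v <> 0 by case: hv.
have w0 : w <> 0 by case: hw.
have hd0 : forall (Mo : glModule C n) (u : Mo), is_highest_weight_vector lam u ->
    above (hwdeg lam) u -> False.
  move=> Mo u hu; rewrite -[u in above _ u]scale1r => /(above_line hu)/eqP.
  by rewrite oner_eq0.
have Nfun y : N 0 y -> y = 0.
  have sub : submodule (N 0).
    split=> // [a x1 x2 h1 h2|i j x h1].
      by have := Nlin a _ _ _ _ h1 h2; rewrite scaler0 addr0.
    by have := NE i j _ _ h1; rewrite linear0.
  case: (Wirr _ sub (NW 0)) => [|allW]; first by apply.
  (* If (0, w) were in the graph, the first component would force c = 0 and the second would then
     put w above its own degree. *)
  have [c [/=]] := pair_decomp hv hw (allW _ Ww).
  rewrite sub0r -[- (c *: v)]scaleNr => /(above_line hv)/eqP.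
  rewrite oppr_eq0 => /eqP ->.
  by rewrite scale0r subr0 => /hd0 -/(_ hw).
have Ninj x : N x 0 -> x = 0.
  have sub : submodule (N^~ 0).
    split=> // [a x1 x2 h1 h2|i j y h1].
      by have := Nlin a _ _ _ _ h1 h2; rewrite scaler0 addr0.
    by have := NE i j _ _ h1; rewrite linear0.
  case: (Mirr _ sub) => // [|allM]; first by apply.
  have [c [/= h]] := pair_decomp hv hw (allM v I).
  rewrite sub0r -[- (c *: w)]scaleNr => /(above_line hw)/eqP.
  rewrite oppr_eq0 => /eqP c0.
  by move: h; rewrite c0 scale0r subr0 => /hd0 -/(_ hv).
have Ntot x : exists y, N x y.
  have sub : submodule (fun x => exists y, N x y).
    split; first by exists 0.
      move=> a x1 x2 [y1 h1] [y2 h2]; exists (a *: y1 + y2); exact: Nlin.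
    by move=> i j x1 [y1 h1]; exists (glE M' i j y1); apply: NE.
  case: (Mirr _ sub) => // [allx0|]; last by apply.
  by case: v0; apply: allx0; exists w.
have Nsurj y : W y -> exists x, N x y.
  have sub : submodule (fun y => exists x, N x y).
    split; first by exists 0.
      move=> a y1 y2 [x1 h1] [x2 h2]; exists (a *: x1 + x2); exact: Nlin.
    by move=> i j y1 [x1 h1]; exists (glE M i j x1); apply: NE.
  case: (Wirr _ sub) => [y1 [x1 /NW] //|ally0|]; last by apply.
  by case: w0; apply: ally0; exists v.
have Nuniq x y y' : N x y -> N x y' -> y = y'.
  move=> h h'; have := Nlin (- 1) _ _ _ _ h h'.
  rewrite scaleN1r addNr scaleN1r => /Nfun /eqP.
  by rewrite addrC subr_eq0 => /eqP.
have [f fP] : exists f : M -> M', forall x, N x (f x).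
  exists (fun x => projT1 (cid (Ntot x))) => x; exact: projT2 (cid (Ntot x)).
have f_lin : linear f.
  by move=> a x y; apply: (Nuniq (a *: x + y)) => //; apply: Nlin.
pose phi0 := GRing.isLinear.Build C M M' _ f f_lin.
pose phi : {linear M -> M'} := HB.pack f phi0.
exists phi; split=> /=.
- move=> x y fxy; have := Nlin (- 1) _ _ _ _ (fP x) (fP y).
  rewrite -fxy !scaleN1r addNr => /Ninj /eqP.
  by rewrite addrC subr_eq0 => /eqP.
- by move=> i j x; apply: (Nuniq (glE M i j x)); [apply: fP|apply: NE; apply: fP].
- move=> y; split=> [/Nsurj [x xy]|[x <-]]; last exact: NW (fP x).
  by exists x; apply: Nuniq xy.
Qed.

Lemma isog_hwv M M' lam (v : M) (W : M' -> Prop) :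
  is_highest_weight_vector lam v -> submodule_isog M W ->
  exists2 w, W w & is_highest_weight_vector lam w.
Proof.
move=> [v0 vr vw] [phi [phi_inj phiE phiW]]; exists (phi v).
  by apply/phiW; exists v.
split.
- by rewrite -(linear0 phi) => /phi_inj.
- by move=> i j ij; rewrite -phiE vr // linear0.
- by move=> i; rewrite -phiE vw linearZ.
Qed.

End HighestWeight.


(** * Tensor powers *)

Section Enveloping.

Variables (C : fieldType) (n : nat).
Implicit Types (M : glModule C n).

Inductive enveloping M : (M -> M) -> Prop :=
| env_id : enveloping id
| env_E (i j : 'I_n) B : enveloping B -> enveloping (fun v => glE M i j (B v))
| env_lin a B B' : enveloping B -> enveloping B' ->
    enveloping (fun v => a *: B v + B' v).

Lemma env_ext M (B B' : M -> M) : B =1 B' -> enveloping B -> enveloping B'.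
Proof. by move=> /funext ->. Qed.

Lemma env0 M : enveloping (fun _ : M => 0).
Proof.
apply: env_ext (env_lin (-1) (@env_id M) (@env_id M)) => v /=.
by rewrite scaleN1r addNr.
Qed.

Lemma env_scale M a (B : M -> M) : enveloping B -> enveloping (fun v => a *: B v).
Proof.
by move=> eB; apply: env_ext (env_lin a eB (env0 M)) => v /=; rewrite addr0.
Qed.

Lemma env_add M (B B' : M -> M) : enveloping B -> enveloping B' ->
  enveloping (fun v => B v + B' v).
Proof.
by move=> eB eB'; apply: env_ext (env_lin 1 eB eB') => v /=; rewrite scale1r.
Qed.

Lemma env_sum M (I : Type) (r : seq I) (P : pred I) (B : I -> M -> M) :
  (forall i, P i -> enveloping (B i)) ->
  enveloping (fun v => \sum_(i <- r | P i) B i v).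
Proof.
move=> eB; elim: r => [|i r IH].
  by apply: env_ext (env0 M) => v; rewrite big_nil.
case Pi: (P i); last by apply: env_ext IH => v; rewrite big_cons Pi.
by apply: env_ext (env_add (eB i Pi) IH) => v; rewrite big_cons Pi.
Qed.

Lemma env_submodule M (B : M -> M) (W : M -> Prop) v :
  submodule W -> enveloping B -> W v -> W (B v).
Proof.
move=> [_ Wlin WE] eB Wv; elim: eB => [//|i j B' _ WB|a B1 B2 _ W1 _ W2].
  exact: WE.
exact: Wlin.
Qed.

(** Together with [pair_decomp] this shows that B acts on two highest weight vectors of the same
    weight by one scalar, up to terms of larger degree. *)
Lemma env_pair M (B : M -> M) (v w : M) : enveloping B ->
  cyclic_submodule ((v, w) : prodModule M M) (B v, B w).
Proof.
have [_ Wlin WE] := cyclic_is_submodule ((v, w) : prodModule M M).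
elim=> [|i j B' _ WB|a B1 B2 _ W1 _ W2].
    exact: (@cyclic_self _ _ (prodModule M M)).
  exact: (WE i j _ WB).
exact: (Wlin a _ _ W1 W2).
Qed.

End Enveloping.

(** * The tensor power and the commutant of the symmetric group *)

Section TensorPower.

Variables (C : numFieldType) (n N : nat).

Definition word : finType := {ffun 'I_N -> 'I_n}.

(* The N-th tensor power of C^n: the value at f is the coefficient of
   e_(f 0) (x) ... (x) e_(f (N - 1)). *)
Definition tensor : vectType C := {ffun word -> C^o}.

Definition tcoef (t : tensor) : word -> C := (t : {ffun word -> C^o}).

(* Locked, as sums and multiples of tensors also unfold to finfun. *)
Definition mktensor (F : word -> C) : tensor :=
  locked [ffun f => (F f : C^o)].

Lemma mktensorE F f : tcoef (mktensor F) f = F f.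
Proof. by rewrite /mktensor -lock /tcoef ffunE. Qed.

Lemma tensorP (t u : tensor) : tcoef t =1 tcoef u <-> t = u.
Proof. by split=> [tu|-> //]; apply/ffunP => f; apply: tu. Qed.

Lemma tcoefD t u f : tcoef (t + u) f = tcoef t f + tcoef u f.
Proof. by rewrite /tcoef ffunE. Qed.
Lemma tcoefZ a t f : tcoef (a *: t) f = a * tcoef t f.
Proof. by rewrite /tcoef ffunE. Qed.
Lemma tcoef0 f : tcoef 0 f = 0.
Proof. by rewrite /tcoef ffunE. Qed.
Lemma tcoef_sum (I : Type) (r : seq I) (P : pred I) (F : I -> tensor) f :
  tcoef (\sum_(i <- r | P i) F i) f = \sum_(i <- r | P i) tcoef (F i) f.
Proof. by elim/big_rec2: _ => [|i x y _ <-]; rewrite ?tcoef0 ?tcoefD. Qed.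

Definition upd (f : word) k i : word := [ffun x => if x == k then i else f x].

(** The Leibniz action, read on coefficients: e_f arises by turning a letter j into i in slot k, so
    f must have i there and the coefficient is taken at the word with j put back. *)
Definition tenE (i j : 'I_n) (t : tensor) : tensor :=
  mktensor (fun f => \sum_k (f k == i)%:R * tcoef t (upd f k j)).

Fact tenE_is_linear i j : linear (tenE i j).
Proof.
move=> a t u; apply/tensorP => f; rewrite tcoefD tcoefZ !mktensorE mulr_sumr.
rewrite -big_split /=; apply: eq_bigr => k _.
by rewrite tcoefD tcoefZ mulrDr mulrCA.
Qed.

HB.instance Definition _ i j :=
  GRing.isLinear.Build C tensor tensor _ (tenE i j) (tenE_is_linear i j).

(** The sum over distinct slots is unchanged when (i, j) and (k, l) are exchanged, hence cancels in
    the bracket; only the terms with both operators in one slot survive. *)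
Lemma tenE_tenE i j k l t f :
  tcoef (tenE i j (tenE k l t)) f = (j == k)%:R * tcoef (tenE i l t) f
   + \sum_p \sum_(q | q != p) (f p == i)%:R * (f q == k)%:R *
        tcoef t (upd (upd f p j) q l).
Proof.
rewrite !mktensorE mulr_sumr -big_split /=; apply: eq_bigr => p _.
rewrite mktensorE mulr_sumr (bigD1 p) //= ffunE eqxx; congr (_ + _).
  rewrite mulrCA; congr (_ * (_ * tcoef t _)).
  by apply/ffunP => x; rewrite !ffunE; case: eqP.
by apply: eq_bigr => q /negPf qp; rewrite ffunE qp mulrA.
Qed.

Fact tenE_bracket (i j k l : 'I_n) (t : tensor) :
  tenE i j (tenE k l t) - tenE k l (tenE i j t)
  = (j == k)%:R *: tenE i l t - (l == i)%:R *: tenE k j t.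
Proof.
apply/tensorP => f; rewrite -!scaleN1r !tcoefD !tcoefZ !tenE_tenE.
rewrite mulrDr addrACA !mulN1r [X in _ + X](_ : _ = 0) ?addr0 //.
apply/eqP; rewrite subr_eq0 (exchange_big_dep xpredT) //=; apply/eqP.
apply: eq_bigr => q _; apply: eq_big => [p|p pq]; first by rewrite eq_sym.
rewrite [X in X * _]mulrC; congr (_ * tcoef t _); apply/ffunP => x.
rewrite !ffunE; case: eqP => [->|//]; case: eqP => // qp.
by rewrite qp eqxx in pq.
Qed.

Definition tensorModule : glModule C n :=
  @GlModule C n tensor (fun i j => tenE i j) tenE_bracket.

Definition precomp (f : word) (s : 'S_N) : word := [ffun x => f (s x)].

Lemma precomp_mapcomp f s u : precomp (precomp f s) u = precomp f (mapcomp s u).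
Proof. by apply/ffunP => x; rewrite !ffunE mapcompE. Qed.

Lemma precompK f s : precomp (precomp f s) s^-1 = f.
Proof. by apply/ffunP => x; rewrite !ffunE permKV. Qed.

Lemma precompKV f s : precomp (precomp f s^-1) s = f.
Proof. by apply/ffunP => x; rewrite !ffunE permK. Qed.

Definition te (f : word) : tensor := mktensor (fun g => (g == f)%:R).

Lemma tensor_expand t : t = \sum_f tcoef t f *: te f.
Proof.
apply/tensorP => g; rewrite tcoef_sum (bigD1 g) //= tcoefZ mktensorE eqxx mulr1.
rewrite big1 ?addr0 // => f /negPf fg.
by rewrite tcoefZ mktensorE eq_sym fg mulr0.
Qed.

Lemma tenE_te i j f :
  tenE i j (te f) = \sum_(k | f k == j) te (upd f k i).
Proof.
apply/tensorP => g; rewrite mktensorE tcoef_sum [RHS]big_mkcond /=.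
apply: eq_bigr => k _; rewrite !mktensorE -natrM mulnb.
case: (f k =P j) => [fk|fk].
  congr (nat_of_bool _)%:R; apply/andP/eqP => [[/eqP gk /eqP <-]|->].
    by apply/ffunP => x; rewrite !ffunE; case: eqP => // ->.
  rewrite ffunE eqxx; split=> //; apply/eqP/ffunP => x.
  by rewrite !ffunE; case: eqP => // ->.
case: andP => // -[_ /eqP guf]; case: fk; rewrite -guf ffunE eqxx //.
Qed.

Definition tact (s : 'S_N) (t : tensor) : tensor :=
  mktensor (fun f => tcoef t (precomp f s^-1)).

Fact tact_is_linear s : linear (tact s).
Proof.
by move=> a t u; apply/tensorP => f; rewrite tcoefD tcoefZ !mktensorE tcoefD tcoefZ.
Qed.

HB.instance Definition _ s :=
  GRing.isLinear.Build C tensor tensor _ (tact s) (tact_is_linear s).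

Lemma tact_te s f : tact s (te f) = te (precomp f s).
Proof.
apply/tensorP => g; rewrite !mktensorE; congr (nat_of_bool _)%:R.
by apply/eqP/eqP => [<-|->]; rewrite ?precompKV ?precompK.
Qed.

Lemma tact_comp s u t : tact u (tact s t) = tact (mapcomp s u) t.
Proof.
apply/tensorP => f; rewrite !mktensorE precomp_mapcomp.
by rewrite /mapcomp invMg.
Qed.

Lemma tact1 t : tact 1 t = t.
Proof.
apply/tensorP => f; rewrite !mktensorE; congr (tcoef t _).
by apply/ffunP => x; rewrite ffunE invg1 perm1.
Qed.

Lemma tactE s i j t : tact s (tenE i j t) = tenE i j (tact s t).
Proof.
apply/tensorP => f; rewrite !mktensorE (reindex_inj (@perm_inj _ s)) /=.
apply: eq_bigr => k _; rewrite mktensorE ffunE permK; congr (_ * tcoef t _).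
apply/ffunP => x; rewrite !ffunE; congr (if _ then _ else _).
by rewrite -[in RHS](permK s k) (inj_eq (@perm_inj _ _)).
Qed.

(** The operator tau_0 (x) ... (x) tau_(N-1). *)
Definition tensop (tau : {ffun 'I_N -> 'M[C]_n}) (t : tensor) : tensor :=
  mktensor (fun f => \sum_(h : word) (\prod_k tau k (f k) (h k)) * tcoef t h).

Definition updm (tau : {ffun 'I_N -> 'M[C]_n}) k A : {ffun 'I_N -> 'M[C]_n} :=
  [ffun x => if x == k then A else tau x].

Lemma tenE_tensop a b tau t :
  tenE a b (tensop tau t)
  = \sum_k tensop (updm tau k (delta_mx a b *m tau k)) t.
Proof.
apply/tensorP => f; rewrite mktensorE tcoef_sum; apply: eq_bigr => k _.
rewrite !mktensorE mulr_sumr; apply: eq_bigr => h _; rewrite mulrA.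
congr (_ * _); rewrite (bigD1 k) //= [RHS](bigD1 k) //= !ffunE !eqxx mulrA.
congr (_ * _).
  rewrite mxE (bigD1 b) //= mxE eqxx andbT big1 ?addr0 // => c /negPf cb.
  by rewrite mxE cb andbF mul0r.
by apply: eq_bigr => x /negPf xk; rewrite !ffunE xk.
Qed.

(** The symmetrization of [tensop tau] over the slots; when every tau k is an elementary matrix it
    is an operator [orbop]. *)
Definition symop (tau : {ffun 'I_N -> 'M[C]_n}) (t : tensor) : tensor :=
  \sum_(s : 'S_N) tensop [ffun k => tau (s k)] t.

Lemma tenE_symop a b tau t :
  tenE a b (symop tau t)
  = \sum_k symop (updm tau k (delta_mx a b *m tau k)) t.
Proof.
rewrite /symop linear_sum exchange_big /=; apply: eq_bigr => s _.
rewrite tenE_tensop [RHS](reindex_inj (@perm_inj _ s)) /=.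
apply: eq_bigr => k _; congr tensop; apply/ffunP => x; rewrite !ffunE.
by rewrite (inj_eq (@perm_inj _ s)).
Qed.

Lemma symop_perm (tau : {ffun 'I_N -> 'M[C]_n}) (u : 'S_N) t :
  symop [ffun k => tau (u k)] t = symop tau t.
Proof.
rewrite /symop [RHS](reindex_inj (mulIg u)) /=; apply: eq_bigr => s _.
by congr tensop; apply/ffunP => x; rewrite !ffunE permM.
Qed.

Lemma tensop0 (tau : {ffun 'I_N -> 'M[C]_n}) k t : tau k = 0 -> tensop tau t = 0.
Proof.
move=> tk; apply/tensorP => f; rewrite mktensorE tcoef0 big1 // => h _.
by rewrite (bigD1 k) //= tk mxE !mul0r.
Qed.

Lemma symop0 (tau : {ffun 'I_N -> 'M[C]_n}) k t : tau k = 0 -> symop tau t = 0.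
Proof.
move=> tk; rewrite /symop big1 // => s _.
by apply: (@tensop0 _ (s^-1%g k)); rewrite ffunE permKV.
Qed.

Lemma word_neq (f h : word) : f != h -> exists k, f k != h k.
Proof.
move=> fh; apply/existsP; apply: contraR fh; rewrite negb_exists => /forallP fh.
by apply/eqP/ffunP => k; apply/eqP; have := fh k; rewrite negbK.
Qed.

Lemma tensop1 t : tensop [ffun=> 1%:M] t = t.
Proof.
apply/tensorP => f; rewrite mktensorE (bigD1 f) //=.
rewrite big1 => [|k _]; last by rewrite ffunE mxE eqxx.
rewrite mul1r big1 ?addr0 // => h; rewrite eq_sym => /word_neq [k kP].
by rewrite (bigD1 k) //= ffunE mxE (negPf kP) !mul0r.
Qed.

(* Induction on the number of tensor slots where tau is not the identity:
   E_ab (symop tau') is a positive multiple of symop tau, where tau fills one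
   more identity slot of tau' with E_ab, plus terms with no more such slots. *)
Lemma symop_env (tau : {ffun 'I_N -> 'M[C]_n}) :
  (forall k, [\/ tau k = 1%:M, tau k = 0 | exists a b, tau k = delta_mx a b]) ->
  enveloping (M := tensorModule) (symop tau).
Proof.
have [c] := ubnP #|[pred k | tau k != 1%:M]|.
elim: c tau => // c IH tau ltc tauP.
have [k0 /= tk0|tau1] := pickP [pred k | tau k != 1%:M]; last first.
  apply: env_ext (env_scale (#|'S_N|%:R) (env_id tensorModule)) => t /=.
  rewrite /symop (eq_bigr (fun=> t)) ?sumr_const ?scaler_nat // => s _.
  rewrite -[RHS]tensop1; congr tensop; apply/ffunP => k; rewrite !ffunE.
  by have /negbFE/eqP := tau1 (s k).
have [/eqP|t0|[a [b tab]]] := tauP k0; first by rewrite (negPf tk0).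
  by apply: env_ext (env0 tensorModule) => t; rewrite (@symop0 _ k0).
pose tau' := updm tau k0 1%:M.
have tau'P k : [\/ tau' k = 1%:M, tau' k = 0 | exists a b, tau' k = delta_mx a b].
  by rewrite ffunE; case: eqP => _; [constructor 1|apply: tauP].
have lttau' : (#|[pred k | tau' k != 1%:M]| < c)%N.
  rewrite -ltnS; apply: leq_trans ltc; rewrite ltnS; apply: proper_card.
  apply/properP; split; last by exists k0; rewrite !inE ?ffunE ?eqxx.
  by apply/subsetP => k; rewrite !inE ffunE; case: ifP => //; rewrite eqxx.
pose S1 := [pred k | tau' k == 1%:M].
have S1k0 : k0 \in S1 by rewrite inE ffunE eqxx.
(* As [symop] is symmetric in the slots, filling any identity slot of [tau'] gives the same
   operator; the transposition of k and [k0] shows it. *)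
have S1E k t : k \in S1 -> symop (updm tau' k (delta_mx a b *m tau' k)) t = symop tau t.
  rewrite inE => /eqP tk; rewrite tk mulmx1 -(symop_perm _ (tperm k k0)).
  congr symop; apply/ffunP => x; rewrite !ffunE.
  case: tpermP => [->|->|/eqP/negPf xk /eqP/negPf xk0].
  - case: eqP => [<-|k0k]; first by rewrite tab.
    by rewrite eqxx -tk ffunE; case: eqP => // kk0; case: k0k.
  - by rewrite eqxx tab.
  - by rewrite xk xk0.
have eR k : k \notin S1 -> enveloping (M := tensorModule)
    (symop (updm tau' k (delta_mx a b *m tau' k))).
  rewrite inE => tk1; apply: IH => [|x].
    apply: leq_ltn_trans lttau'; apply: subset_leq_card; apply/subsetP => x.
    by rewrite !inE [updm _ k _ x]ffunE; case: (x =P k) => [->|].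
  rewrite [updm _ k _ x]ffunE; case: (x =P k) => // _.
  have [/eqP|->|[a' [b' ->]]] := tau'P k; first by rewrite (negPf tk1).
    by constructor 2; rewrite mulmx0.
  have [ba|ba] := eqVneq b a'.
    by constructor 3; exists a, b'; rewrite ba mul_delta_mx.
  by constructor 2; rewrite mul_delta_mx_0.
have S1n0 : #|S1|%:R != 0 :> C.
  by rewrite pnatr_eq0 -lt0n; apply/card_gt0P; exists k0.
apply: env_ext (env_scale (#|S1|%:R^-1) (env_add (env_E a b (IH _ lttau' tau'P))
   (env_scale (-1) (env_sum (index_enum _) eR)))) => t /=.
rewrite [X in X + _]tenE_symop (bigID (mem S1)) /= scaleN1r addrK.
rewrite (eq_bigr (fun=> symop tau t)) => [|k kS]; last by rewrite S1E.
by rewrite sumr_const -scaler_nat scalerA mulVf // scale1r.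
Qed.

(** The matrix unit taking [te h] to [te f], summed over simultaneous permutations of both words. *)
Definition orbop (f h : word) (t : tensor) : tensor :=
  \sum_(s : 'S_N) tcoef t (precomp h s) *: te (precomp f s).

(* The operators orbop f h span the commutant of the symmetric group: this is
   the half of Schur-Weyl duality that is needed. *)
Lemma orbop_env f h : enveloping (M := tensorModule) (orbop f h).
Proof.
have tauP k : [\/ [ffun k => delta_mx (f k) (h k)] k = 1%:M :> 'M[C]_n,
   [ffun k => delta_mx (f k) (h k)] k = 0 :> 'M[C]_n
   | exists a b, [ffun k => delta_mx (f k) (h k)] k = delta_mx a b :> 'M[C]_n].
  by rewrite ffunE; constructor 3; exists (f k), (h k).
apply: env_ext (symop_env tauP) => t; apply: eq_bigr => s _.
apply/tensorP => g; rewrite mktensorE tcoefZ mktensorE (bigD1 (precomp h s)) //=.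
rewrite mulrC [X in _ + X]big1 ?addr0 => [|h' hh']; last first.
  have [k] := word_neq hh'.
  rewrite ffunE (bigD1 k) //= !ffunE mxE => /negPf ->.
  by rewrite andbF !mul0r.
congr (_ * _); have [->|] := eqVneq g (precomp f s).
  by rewrite big1 // => k _; rewrite !ffunE mxE !eqxx.
move=> /word_neq [k]; rewrite ffunE (bigD1 k) //= !ffunE mxE => /negPf ->.
by rewrite mul0r.
Qed.

End TensorPower.


(** A subspace of largest dimension contained in V is all of V, since adding the line of a vector of
    V cannot enlarge it. *)
Lemma vspace_of_pred (K : fieldType) (vT : vectType K) (V : vT -> Prop) :
  V 0 -> (forall (a : K) v w, V v -> V w -> V (a *: v + w)) ->
  exists Y : {vspace vT}, forall v, v \in Y <-> V v.
Proof.
move=> V0 Vlin.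
pose Q m := `[< exists Y : {vspace vT}, \dim Y = m /\ forall v, v \in Y -> V v >].
have exQ : exists m, Q m.
  exists 0%N; apply/asboolP; exists 0%VS; rewrite dimv0; split=> // v.
  by rewrite memv0 => /eqP ->.
have bQ m : Q m -> (m <= \dim {:vT})%N.
  by move=> /asboolP[Y [<- _]]; apply/dimvS/subvf.
have [m /asboolP[Y [dY YV]] maxm] := ex_maxnP exQ bQ.
exists Y => v; split=> [/YV //|Vv].
have /maxm : Q (\dim (<[v]> + Y)).
  apply/asboolP; exists (<[v]> + Y)%VS; split=> // w /memv_addP[_ /vlineP[a ->]].
  by move=> [y /YV Vy ->]; apply: Vlin.
move=> le_dim; have /eqP -> : (Y == <[v]> + Y)%VS by rewrite eqEdim addvSr dY.
exact: subvP (addvSl _ _) _ (memv_line v).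
Qed.

(** * Complete reducibility and highest weight vectors in the tensor power *)

Section Unitary.

Variables (C : numClosedFieldType) (n N : nat).

Local Notation tensor := (tensor C n N).
Local Notation word := (word n N).

Definition tdot (x y : tensor) : C := \sum_f tcoef x f * (tcoef y f)^*.

Definition tdotl y x := tdot x y.

Fact tdotl_linear y : linear_for *%R (tdotl y).
Proof.
move=> a u v; rewrite /tdotl /tdot mulr_sumr -big_split /=; apply: eq_bigr => f _.
by rewrite tcoefD tcoefZ mulrDl mulrA.
Qed.

HB.instance Definition _ y :=
  GRing.isLinear.Build C tensor C *%R (tdotl y) (tdotl_linear y).

Lemma tdot0l y : tdot 0 y = 0. Proof. exact: (linear0 (tdotl y)). Qed.
Lemma tdotZl a x y : tdot (a *: x) y = a * tdot x y.
Proof. exact: (linearZ_LR (tdotl y)). Qed.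
Lemma tdotDl x z y : tdot (x + z) y = tdot x y + tdot z y.
Proof. exact: (linearD (tdotl y)). Qed.
Lemma tdot_suml (I : Type) (r : seq I) (P : pred I) (F : I -> tensor) y :
  tdot (\sum_(i <- r | P i) F i) y = \sum_(i <- r | P i) tdot (F i) y.
Proof. exact: (linear_sum (tdotl y)). Qed.

Lemma tdotC x y : tdot x y = (tdot y x)^*.
Proof.
rewrite /tdot rmorph_sum /=; apply: eq_bigr => f _.
by rewrite rmorphM /= conjCK mulrC.
Qed.

Lemma tdot_eq0 x : tdot x x = 0 -> x = 0.
Proof.
move=> /eqP; rewrite psumr_eq0 => [|f _]; last exact: mul_conjC_ge0.
move=> /allP x0; apply/tensorP => f; rewrite tcoef0; apply/eqP.
by rewrite -mul_conjC_eq0; apply: (x0 f); rewrite mem_index_enum.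
Qed.

Lemma upd_upd (f : word) k i j : upd (upd f k i) k j = upd f k j.
Proof. by apply/ffunP => x; rewrite !ffunE; case: eqP. Qed.

Lemma upd_id (f : word) k : upd f k (f k) = f.
Proof. by apply/ffunP => x; rewrite !ffunE; case: eqP => [->|]. Qed.

(** The unitarian trick: as E_ij and E_ji are adjoint, orthogonal complements of submodules are
    submodules. Slot by slot, words with i in slot k are matched with words with j there. *)
Lemma tdot_E i j x y : tdot (tenE i j x) y = tdot x (tenE j i y).
Proof.
rewrite /tdot.
under eq_bigr => f _ do rewrite mktensorE mulr_suml.
under [RHS]eq_bigr => f _ do rewrite mktensorE rmorph_sum mulr_sumr.
rewrite exchange_big [RHS]exchange_big /=; apply: eq_bigr => k _.
rewrite (bigID (fun f : word => f k == i)) /= [X in _ + X]big1 ?addr0; last first.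
  by move=> f /negPf ->; rewrite !mul0r.
rewrite [RHS](bigID (fun f : word => f k == j)) /=.
rewrite [X in _ = _ + X]big1 ?addr0; last first.
  by move=> f /negPf ->; rewrite mul0r rmorph0 mulr0.
rewrite [RHS](reindex_onto (fun f : word => upd f k j) (fun f => upd f k i)) /=.
  apply: eq_big => [f|f fk].
    rewrite upd_upd [upd f k j k]ffunE !eqxx /=; apply/eqP/eqP => [fk|<-].
      by rewrite -[in LHS]fk upd_id.
    by rewrite ffunE eqxx.
  by rewrite fk [upd f k j k]ffunE !eqxx !mul1r upd_upd -(eqP fk) upd_id.
by move=> f /eqP fk; rewrite upd_upd -fk upd_id.
Qed.

Lemma precomp_inj (s : 'S_N) : injective (fun f : word => precomp f s).
Proof.
by apply: (can_inj (g := fun f : word => precomp f s^-1)) => f; apply: precompK.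
Qed.

Definition tdots (U : {vspace tensor}) (x : tensor) : 'rV[C]_(\dim U) :=
  \row_i tdot x (vbasis U)`_i.

Fact tdots_linear U : linear (tdots U).
Proof. by move=> a x y; apply/rowP => i; rewrite !mxE tdotDl tdotZl. Qed.

HB.instance Definition _ U :=
  GRing.isLinear.Build C tensor 'rV[C]_(\dim U) _ (tdots U) (tdots_linear U).

Definition torth (U : {vspace tensor}) : {vspace tensor} := lker (linfun (tdots U)).

Lemma mem_torth U x : x \in torth U <-> forall u, u \in U -> tdot x u = 0.
Proof.
rewrite memv_ker lfunE /=; split=> [/eqP/rowP x0 u|x0].
  move=> /coord_vbasis ->; rewrite tdotC tdot_suml big1 ?rmorph0 // => i _.
  by have := x0 i; rewrite !mxE tdotZl [tdot _ x]tdotC => ->; rewrite rmorph0 mulr0.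
apply/eqP/rowP => i; rewrite !mxE x0 //; apply: vbasis_mem.
by rewrite mem_nth // size_tuple.
Qed.

Lemma torth_cap U : (U :&: torth U = 0)%VS.
Proof.
apply/eqP; rewrite -subv0; apply/subvP => x /memv_capP[xU /mem_torth xo].
by rewrite memv0; apply/eqP/tdot_eq0/xo.
Qed.

(** Rank-nullity: the orthogonal complement is the kernel of a map into a space of dimension \dim
    U. *)
Lemma torth_add U : (U + torth U = fullv)%VS.
Proof.
apply/eqP; rewrite eqEdim subvf /= dimv_disjoint_sum ?torth_cap //.
rewrite -(limg_ker_dim (linfun (tdots U)) fullv) capfv addnC leq_add2r.
by apply: leq_trans (dimvS (subvf _)) _; rewrite dimvf dim_matrix mul1r.
Qed.

Definition tstable (U : {vspace tensor}) : Prop :=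
  forall i j t, t \in U -> tenE i j t \in U.

Lemma torth_stable U : tstable U -> tstable (torth U).
Proof.
move=> Ust i j t /mem_torth tU; apply/mem_torth => u uU.
by rewrite tdot_E; apply/tU/Ust.
Qed.

Lemma tstable_submodule U : tstable U ->
  submodule (M := tensorModule C n N) (fun t => t \in U).
Proof.
move=> Ust; split; [exact: mem0v| |exact: Ust].
by move=> a v w vU wU; rewrite memvD ?memvZ.
Qed.

Definition tirr (X : {vspace tensor}) : Prop :=
  X <> 0%VS /\ forall Y, tstable Y -> (Y <= X)%VS -> Y = 0%VS \/ Y = X.

Lemma tirr_exists U : tstable U -> U <> 0%VS ->
  exists X, [/\ tstable X, tirr X & (X <= U)%VS].
Proof.
have [m] := ubnP (\dim U); elim: m U => // m IH U leU Ust U0.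
have [[Y [Yst YU Y0 YneU]]|noY] :=
  EM (exists Y, [/\ tstable Y, (Y <= U)%VS, Y <> 0%VS & Y <> U]).
  have [|X [Xst Xirr XY]] := IH Y _ Yst Y0.
    apply: leq_trans (_ : \dim Y < \dim U)%N _; last by rewrite -ltnS.
    by rewrite (ltn_leqif (dimv_leqif_eq YU)); apply/eqP.
  by exists X; split=> //; apply: subv_trans YU.
exists U; split=> //; split=> // Y Yst YU.
have [->|/eqP Y0] := eqVneq Y 0%VS; first by left.
have [->|/eqP YneU] := eqVneq Y U; first by right.
by case: noY; exists Y.
Qed.

(** An irreducible X is split off, and the argument continues in the orthogonal complement of X in
    U. The equality of dimensions records that the sum is direct. *)
Lemma tstable_decomp U : tstable U ->
  exists Us : seq {vspace tensor},
    [/\ forall X, X \in Us -> tstable X /\ tirr X,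
        U = (\sum_(X <- Us) X)%VS
      & \dim U = (\sum_(X <- Us) \dim X)%N].
Proof.
have [m] := ubnP (\dim U); elim: m U => // m IH U leU Ust.
have [->|/eqP U0] := eqVneq U 0%VS.
  by exists [::]; rewrite !big_nil dimv0.
have [X [Xst Xirr XU]] := tirr_exists Ust U0.
have Vst : tstable (U :&: torth X).
  move=> i j t /memv_capP[tU tX]; apply/memv_capP; split; first exact: Ust.
  exact: torth_stable.
have UE : (X + (U :&: torth X) = U)%VS.
  by rewrite capvC vspace_modl // torth_add capfv.
have XV0 : (X :&: (U :&: torth X) = 0)%VS.
  by rewrite [(U :&: _)%VS]capvC capvA torth_cap cap0v.
have dU : \dim U = (\dim X + \dim (U :&: torth X))%N.
  by rewrite -dimv_disjoint_sum // UE.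
have [|Us [UsP UsE Usd]] := IH (U :&: torth X)%VS _ Vst.
  apply: leq_trans (_ : \dim (U :&: torth X) < \dim U)%N _; last by rewrite -ltnS.
  by rewrite dU -[X in (X < _)%N]add0n ltn_add2r lt0n dimv_eq0; case: Xirr => /eqP.
exists (X :: Us); rewrite !big_cons -UsE -Usd; split=> // Y.
by rewrite inE => /orP[/eqP ->|/UsP].
Qed.

Definition hwspace (lam : seq nat) : {vspace tensor} :=
  ((\bigcap_(p : 'I_n * 'I_n | (p.1 < p.2)%N) lker (linfun (tenE p.1 p.2)))
   :&: \bigcap_(i < n) lker (linfun (tenE i i) - (nth 0%N lam i)%:R *: \1%VF))%VS.

Lemma mem_hwspace lam t : t \in hwspace lam <->
  (forall i j : 'I_n, (i < j)%N -> tenE i j t = 0) /\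
  (forall i : 'I_n, tenE i i t = (nth 0%N lam i)%:R *: t).
Proof.
rewrite memv_cap; split.
  move=> /andP[/subv_bigcapP rais /subv_bigcapP wt]; split=> [i j ij|i].
    by have := rais (i, j) ij; rewrite -memvE memv_ker lfunE => /eqP.
  have := wt i isT; rewrite -memvE memv_ker add_lfunE opp_lfunE scale_lfunE id_lfunE.
  by rewrite lfunE subr_eq0 => /eqP.
move=> [rais wt]; apply/andP; split; apply/subv_bigcapP.
  by move=> [i j] ij; rewrite -memvE memv_ker lfunE /= rais.
move=> i _; rewrite -memvE memv_ker add_lfunE opp_lfunE scale_lfunE id_lfunE.
by rewrite lfunE /= wt subrr.
Qed.

Lemma hwspace_hwv lam t : t \in hwspace lam -> t <> 0 ->
  is_highest_weight_vector (M := tensorModule C n N) lam t.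
Proof. by move=> /mem_hwspace[]. Qed.

Lemma hwspace_act lam s t : t \in hwspace lam -> tact s t \in hwspace lam.
Proof.
move=> /mem_hwspace[rais wt]; apply/mem_hwspace; split=> [i j ij|i].
  by rewrite -tactE rais // linear0.
by rewrite -tactE wt linearZ.
Qed.

(* The operator y |-> \sum_s <y, t.s> t.s lies in the enveloping algebra, so it
   acts on t and t' by the same scalar up to vectors of other weights; it kills
   t', and its scalar on t is nonzero. *)
Lemma hwspace_orth lam t t' : t \in hwspace lam -> t' \in hwspace lam ->
  t <> 0 -> (forall s, tdot t' (tact s t) = 0) -> t' = 0.
Proof.
move=> tl tl' t0 tt'; apply: contrapT => t'0.
have ht := hwspace_hwv tl t0; have ht' := hwspace_hwv tl' t'0.
pose B (y : tensor) := \sum_(s : 'S_N) tdot y (tact s t) *: tact s t.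
have eB : enveloping (M := tensorModule C n N) B.
  (* Expanding both occurrences of t in words writes B as the combination of the [orbop f h] with
     coefficients t_f (t_h)^*. *)
  apply: env_ext (env_sum (M := tensorModule C n N) (index_enum _) (P := xpredT)
    (B := fun p : word * word => fun y =>
       (tcoef t p.1 * (tcoef t p.2)^*) *: orbop p.1 p.2 y) _).
    move=> y; rewrite -(pair_bigA _ (fun f h : word =>
      (tcoef t f * (tcoef t h)^*) *: orbop f h y : tensor)) /=.
    under eq_bigr => f _ do
      (under eq_bigr => h _ do rewrite scaler_sumr; rewrite exchange_big /=).
    rewrite exchange_big; apply: eq_bigr => s _ /=.
    rewrite [X in _ = _ *: tact _ X](tensor_expand t) linear_sum scaler_sumr /=.
    apply: eq_bigr => f _ /=.
    rewrite linearZ /= tact_te scalerA /tdot [in RHS](reindex_inj (@precomp_inj s)) /=.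
    rewrite mulr_suml scaler_suml; apply: eq_bigr => h _.
    rewrite scalerA mktensorE precompK; congr (_ *: _).
    by rewrite mulrC mulrA mulrAC.
  by move=> [f h] _; apply: env_scale; apply: orbop_env.
have [c [/= a1 a2]] :=
  pair_decomp ht' ht (@env_pair _ _ (tensorModule C n N) B t' t eB).
have Bt'0 : B t' = 0 by rewrite /B big1 // => s _; rewrite tt' scale0r.
have c0 : c = 0.
  move: a1; rewrite Bt'0 sub0r -scaleNr => /(above_line ht')/eqP.
  by rewrite oppr_eq0 => /eqP.
move: a2; rewrite c0 scale0r subr0 => aBt.
have Bl : B t \in hwspace lam.
  by apply: rpred_sum => s _; apply: memvZ; apply: hwspace_act.
have Bt0 : B t = 0.
  apply: contrapT => Bn0; have hB := hwspace_hwv Bl Bn0.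
  move: aBt; rewrite -[X in above _ X](scale1r (B t : tensorModule C n N)).
  by move=> /(above_line hB)/eqP; rewrite oner_eq0.
(* This inner product is \sum_s |<t, t.s>|^2, and its term at s = 1 is <t, t>^2. *)
have : tdot (B t) t = 0 by rewrite Bt0 tdot0l.
rewrite tdot_suml => /eqP; rewrite psumr_eq0 => [/allP/(_ 1%g)|s _]; last first.
  by rewrite tdotZl [tdot (tact s t) t]tdotC mul_conjC_ge0.
rewrite mem_index_enum tact1 tdotZl mulf_eq0 orbb => /(_ isT)/eqP/tdot_eq0.
by move=> /t0.
Qed.

(** Irreducibility under the symmetric group: the component of a highest weight vector orthogonal to
    Y is orthogonal to all translates of a nonzero t in Y, hence zero by [hwspace_orth]. *)
Lemma hwspace_minimal lam (Y : {vspace tensor}) :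
  (Y <= hwspace lam)%VS -> Y <> 0%VS ->
  (forall s t, t \in Y -> tact s t \in Y) -> Y = hwspace lam.
Proof.
move=> Yl Y0 Yact; apply/eqP; rewrite eqEsubv Yl /=; apply/subvP => v vl.
have : v \in (Y + torth Y)%VS by rewrite torth_add memvf.
move=> /memv_addP[y yY [z /mem_torth zY vE]].
have zl : z \in hwspace lam.
  have -> : z = v - y by rewrite vE addrC addKr.
  by rewrite memvB // (subvP Yl).
have [t tY t0] : exists2 t, t \in Y & t <> 0.
  by exists (vpick Y); [exact: memv_pick|apply/eqP; rewrite vpick0; apply/eqP].
rewrite vE (hwspace_orth (subvP Yl _ tY) zl t0) ?addr0 // => s.
by apply: zY; apply: Yact.
Qed.

(** To lift a highest weight vector of the image, a preimage is taken in the orthogonal complement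
    of the kernel. That complement is a submodule on which rho is injective, so the lift satisfies
    the same equations. *)
Lemma hwspace_img lam (rho : 'End(tensor)) :
  (forall i j t, rho (tenE i j t) = tenE i j (rho t)) ->
  (hwspace lam :&: limg rho)%VS = (rho @: hwspace lam)%VS.
Proof.
move=> rhoE; apply/eqP; rewrite eqEsubv.
apply/andP; split; apply/subvP => y; last first.
  move=> /memv_imgP[t /mem_hwspace[rais wt] ->].
  rewrite memv_cap memv_img ?memvf // andbT; apply/mem_hwspace.
  by split=> [i j ij|i]; rewrite -rhoE; [rewrite rais // linear0|rewrite wt linearZ].
move=> /memv_capP[/mem_hwspace[rais wt] /memv_imgP[x _ yE]].
have Kst : tstable (lker rho).
  by move=> i j t; rewrite !memv_ker rhoE => /eqP ->; rewrite linear0.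
have : x \in (lker rho + torth (lker rho))%VS by rewrite torth_add memvf.
move=> /memv_addP[x1 x1K [x2 x2K xE]].
have {xE}yE : y = rho x2.
  by move: x1K; rewrite memv_ker yE xE linearD => /eqP /= ->; rewrite add0r.
have inj z : z \in torth (lker rho) -> rho z = 0 -> z = 0.
  move=> zK z0; apply/eqP; rewrite -memv0 -(torth_cap (lker rho)) memv_cap zK andbT.
  by rewrite memv_ker z0.
rewrite yE memv_img //; apply/mem_hwspace; split=> [i j ij|i].
  by apply: inj; [apply: torth_stable|rewrite rhoE -yE rais].
apply/eqP; rewrite -subr_eq0; apply/eqP/inj.
  by rewrite memvB ?memvZ //; apply: torth_stable.
by rewrite linearB linearZ /= rhoE -yE wt subrr.
Qed.

Lemma tirr_irreducible (X : {vspace tensor}) : tstable X -> tirr X ->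
  irreducible_submodule (M := tensorModule C n N) (fun t => t \in X).
Proof.
move=> Xst [X0 Xirr]; split; first exact: tstable_submodule.
  by exists (vpick X); [exact: memv_pick|apply/eqP; rewrite vpick0; apply/eqP].
move=> V [V0 Vlin VE] VX.
have [Y YV] := vspace_of_pred V0 Vlin.
have Yst : tstable Y by move=> i j t /YV Vt; apply/YV/VE.
have [|Y0|YX] := Xirr Y Yst; first by apply/subvP => t /YV/VX.
  by left=> t /YV; rewrite Y0 memv0 => /eqP.
by right=> t tX; apply/YV; rewrite YX.
Qed.

(** The intersection is at most a line, by [hwv_unique]. *)
Lemma dim_hwspace_irr lam (X : {vspace tensor}) : tstable X -> tirr X ->
  \dim (hwspace lam :&: X) = ((hwspace lam :&: X)%VS != 0%VS).
Proof.
move=> Xst Xirr; have [->|h0] := eqVneq (hwspace lam :&: X)%VS 0%VS.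
  by rewrite dimv0.
pose t := vpick (hwspace lam :&: X).
have t0 : t != 0 by rewrite vpick0.
have /memv_capP[tl tX] : t \in (hwspace lam :&: X)%VS by apply: memv_pick.
rewrite (_ : (_ :&: _)%VS = <[t]>%VS) ?dim_vline ?t0 //.
apply/eqP; rewrite eqEsubv -memvE memv_pick andbT; apply/subvP => w /memv_capP[wl wX].
have [->|/eqP w0] := eqVneq w 0; first exact: mem0v.
have := hwv_unique (tirr_irreducible Xst Xirr) tX wX
  (hwspace_hwv tl (elimN eqP t0)) (hwspace_hwv wl w0).
by move=> [c ->]; apply/vlineP; exists c.
Qed.

(** The equations defining a highest weight vector hold in a direct sum of submodules exactly when
    they hold in each component; each summand then contributes 0 or 1. *)
Lemma dim_hwspace_sum lam k (Us : 'I_k -> {vspace tensor}) :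
  (forall i, tstable (Us i)) -> (forall i, tirr (Us i)) ->
  directv (\sum_i Us i) ->
  \dim (hwspace lam :&: \sum_i Us i)
  = #|[set i | (hwspace lam :&: Us i)%VS != 0%VS]|.
Proof.
move=> Ust Uirr Udir.
have indep := directv_sum_independent Udir.
rewrite (_ : (_ :&: _)%VS = (\sum_i (hwspace lam :&: Us i))%VS); last first.
  apply/eqP; rewrite eqEsubv; apply/andP; split; last first.
    apply/subv_sumP => i _; apply: capvS (subvv _) _.
    exact: (sumv_sup i).
  apply/subvP => t /memv_capP[/mem_hwspace[rais wt] /memv_sumP[u uU tE]].
  rewrite tE; apply: memv_sumr => i _; rewrite memv_cap uU // andbT.
  apply/mem_hwspace; split=> [a b ab|a].
    apply: (indep (fun i => tenE a b (u i))) => // [j _|].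
      by apply/Ust/uU.
    by have := rais a b ab; rewrite tE linear_sum.
  apply/eqP; rewrite -subr_eq0; apply/eqP.
  apply: (indep (fun i => tenE a a (u i) - (nth 0%N lam a)%:R *: u i) _ _ i isT).
    by move=> j _; rewrite memvB ?memvZ ?uU //; apply/Ust/uU.
  by rewrite sumrB -linear_sum -scaler_sumr /= -tE wt subrr.
have dir : directv (\sum_i (hwspace lam :&: Us i)).
  apply/directv_sum_independent => u uU; apply: indep => i _.
  by have /memv_capP[] := uU i isT.
rewrite (directvP dir) /= -sum1_card [RHS]big_mkcond /=; apply: eq_bigr => i _.
by rewrite dim_hwspace_irr // inE; case: eqP.
Qed.

(** The injective p carries a decomposition of U into irreducibles over to P. A summand is
    isomorphic to M exactly when it contains a highest weight vector of weight lam, and the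
    dimension counts these summands. *)
Lemma hwspace_multiplicity lam (M P : glModule C n) (p : {linear tensor -> P})
    (U : {vspace tensor}) :
  irreducible_of_highest_weight M lam ->
  (forall i j t, p (tenE i j t) = glE P i j (p t)) ->
  (forall t, t \in U -> p t = 0 -> t = 0) ->
  tstable U ->
  has_multiplicity M (fun y => exists2 t, t \in U & p t = y)
    (\dim (hwspace lam :&: U)).
Proof.
move=> [Mirr [v hv]] pE pinj Ust.
have [Us0 [UsP UE Ud]] := tstable_decomp Ust.
pose k := size Us0; pose Us (i : 'I_k) := nth 0%VS Us0 i.
have {}UsP i : tstable (Us i) /\ tirr (Us i) by apply/UsP/mem_nth.
have {}UE : U = (\sum_i Us i)%VS by rewrite UE (big_nth 0%VS) big_mkord.
have Udir : directv (\sum_i Us i).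
  by rewrite directvE /= -UE Ud (big_nth 0%VS) big_mkord.
have indep := directv_sum_independent Udir.
have UsU i t : t \in Us i -> t \in U.
  by move=> ti; rewrite UE; apply: (subvP (sumv_sup i _ _)) ti.
have pirr i : irreducible_submodule (M := P) (fun y => exists2 t, t \in Us i & p t = y).
  have [iSt iIrr] := UsP i.
  have [_ [w wi w0] irr] := tirr_irreducible iSt iIrr.
  split; first split.
  - by exists 0; rewrite ?mem0v ?linear0.
  - move=> a _ _ [x xi <-] [y yi <-]; exists (a *: x + y); last by rewrite linearP.
    by rewrite memvD ?memvZ.
  - by move=> a b _ [x xi <-]; exists (tenE a b x); [apply: iSt|rewrite pE].
  - exists (p w); first by exists w.
    by move=> /(pinj _ (UsU _ _ wi)).
  - move=> V [V0 Vlin VE] VX.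
    have sub : submodule (M := tensorModule C n N) (fun t => t \in Us i /\ V (p t)).
      split; first by rewrite mem0v linear0.
        move=> a x y [xi Vx] [yi Vy]; rewrite memvD ?memvZ // linearP.
        by split=> //; apply: Vlin.
      by move=> a b x [xi Vx]; split; [apply: iSt|rewrite pE; apply: VE].
    have [|V0'|Vall] := irr _ sub; first by move=> t [].
      by left=> y Vy; have [t ti ty] := VX y Vy; rewrite -ty (V0' t) ?linear0 // ty.
    by right=> y [t ti <-]; have [] := Vall t ti.
have Uhw i : (hwspace lam :&: Us i)%VS != 0%VS <->
    submodule_isog M (fun y : P => exists2 t, t \in Us i & p t = y).
  split=> [h0|/(isog_hwv hv)[y [t ti ty] [y0 rais wt]]].
    pose t := vpick (hwspace lam :&: Us i).
    have t0 : t <> 0 by apply/eqP; rewrite vpick0.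
    have /memv_capP[/mem_hwspace[rais wt] ti] : t \in (hwspace lam :&: Us i)%VS.
      by apply: memv_pick.
    apply: (@hw_isog _ _ M P lam v _ (p t)) => //; first by exists t.
    split; first by move=> /(pinj _ (UsU _ _ ti)).
      by move=> a b ab; rewrite -pE rais // linear0.
    by move=> a; rewrite -pE wt linearZ.
  apply/eqP => h0; case: y0; rewrite -ty (_ : t = 0) ?linear0 //.
  apply/eqP; rewrite -memv0 -h0 memv_cap ti andbT; apply/mem_hwspace.
  have [iSt _] := UsP i.
  split=> [a b ab|a].
    apply: pinj; first by apply/UsU/iSt.
    by rewrite pE ty rais.
  apply/eqP; rewrite -subr_eq0; apply/eqP/pinj.
    by rewrite memvB ?memvZ ?(UsU i) //; apply: iSt.
  by rewrite linearB linearZ /= pE ty wt subrr.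
exists k, (fun i y => exists2 t, t \in Us i & p t = y).
exists [set i | (hwspace lam :&: Us i)%VS != 0%VS]; split.
- split=> [y|u uU sum0 i].
    split=> [[t]|[u uU ->]].
      rewrite {1}UE => /memv_sumP[u uU tE] <-.
      exists (fun i => p (u i)); last by rewrite tE linear_sum.
      by move=> i; exists (u i); rewrite // uU.
    have [w wP] : exists w : 'I_k -> tensor, forall i, w i \in Us i /\ p (w i) = u i.
      have ex i : exists t, t \in Us i /\ p t = u i by have [t] := uU i; exists t.
      by exists (fun i => projT1 (cid (ex i))) => i; exact: projT2 (cid (ex i)).
    exists (\sum_i w i).
      by rewrite UE; apply: memv_sumr => i _; have [] := wP i.
    by rewrite linear_sum; apply: eq_bigr => i _; have [] := wP i.
  have [w wP] : exists w : 'I_k -> tensor, forall i, w i \in Us i /\ p (w i) = u i.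
    have ex j : exists t, t \in Us j /\ p t = u j by have [t] := uU j; exists t.
    by exists (fun i => projT1 (cid (ex i))) => j; exact: projT2 (cid (ex j)).
  have [_ <-] := wP i; rewrite (indep w) ?linear0 // => [j _|].
    by have [] := wP j.
  apply: pinj; first by rewrite UE; apply: memv_sumr => j _; have [] := wP j.
  by rewrite -sum0 linear_sum; apply: eq_bigr => j _; have [] := wP j.
- exact: pirr.
- by move=> i; rewrite inE.
- rewrite UE dim_hwspace_sum // => i; [exact: (UsP i).1|exact: (UsP i).2].
Qed.

End Unitary.


(** * Specht modules and highest weight vectors *)

Section GroupAlgebra.

Variables (C : numClosedFieldType) (N : nat).

Implicit Types (a x : groupAlg C N).

Definition acoef x : 'S_N -> C := (x : {ffun 'S_N -> C^o}).

Lemma acoefD x y g : acoef (x + y) g = acoef x g + acoef y g.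
Proof. by rewrite /acoef ffunE. Qed.
Lemma acoefZ c x g : acoef (c *: x) g = c * acoef x g.
Proof. by rewrite /acoef ffunE. Qed.
Lemma acoef0 g : acoef 0 g = 0.
Proof. by rewrite /acoef ffunE. Qed.
Lemma acoef_galg g h : acoef (galg C g) h = (h == g)%:R.
Proof. by rewrite /acoef ffunE. Qed.
Lemma acoef_mulr x g h : acoef (galg_mulr x g) h = acoef x (mapcomp h g^-1).
Proof. by rewrite /acoef ffunE. Qed.

Lemma acoefP x y : acoef x =1 acoef y <-> x = y.
Proof. by split=> [xy|-> //]; apply/ffunP => g; apply: xy. Qed.

Definition gmulr (g : 'S_N) x : groupAlg C N := galg_mulr x g.

Fact gmulr_is_linear g : linear (gmulr g).
Proof.
move=> c x y; apply/acoefP => h.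
by rewrite acoefD acoefZ !acoef_mulr acoefD acoefZ.
Qed.

HB.instance Definition _ g :=
  GRing.isLinear.Build C (groupAlg C N) (groupAlg C N) _ (gmulr g)
    (gmulr_is_linear g).

Definition galgR (g : 'S_N) : 'End(groupAlg C N) := linfun (gmulr g).

Lemma galgRE g x : galgR g x = galg_mulr x g.
Proof. exact: lfunE. Qed.

Lemma mapcompKV (g h : 'S_N) : mapcomp (mapcomp g h) h^-1 = g.
Proof. by rewrite /mapcomp mulKg. Qed.

Lemma mapcompI (g : 'S_N) : injective (fun h => mapcomp h g).
Proof.
by apply: (can_inj (g := fun h => mapcomp h g^-1)) => h; apply: mapcompKV.
Qed.

Lemma galg_mulr_comp x g h :
  galg_mulr (galg_mulr x g) h = galg_mulr x (mapcomp g h).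
Proof.
apply/acoefP => s; rewrite !acoef_mulr; congr (acoef x _).
by rewrite /mapcomp invMg mulgA.
Qed.

Section RightAction.

Variables (V : vectType C) (act : 'S_N -> 'End(V)).

(** Defined for an arbitrary family of endomorphisms, as it is applied to tensors, to S and to the
    group algebra itself. *)
Definition actA a : 'End(V) := \sum_g acoef a g *: act g.

Lemma actAE a v : actA a v = \sum_g acoef a g *: act g v.
Proof. by rewrite sum_lfunE; apply: eq_bigr => g _; rewrite scale_lfunE. Qed.

End RightAction.

End GroupAlgebra.

(** * The Specht module inside the tensor power *)

Section SpechtTensor.

Variables (C : numClosedFieldType) (n N : nat) (lam : seq nat).
Hypothesis lam_part : is_partition lam N.
Hypothesis lam_size : (size lam <= n)%N.

Local Notation tensor := (tensor C n N).
Local Notation word := (word n N).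

Let lam_sum : sumn lam = N.
Proof. by case/and3P: lam_part => _ _ /eqP. Qed.

Lemma row_lt (k : 'I_N) : (reshape_index lam k < n)%N.
Proof. by apply: leq_trans lam_size; apply: reshape_indexP; rewrite lam_sum. Qed.

Definition hw_word : word := [ffun k => Ordinal (row_lt k)].

Lemma hw_wordE k : hw_word k = reshape_index lam k :> nat.
Proof. by rewrite ffunE. Qed.

Lemma card_row (i : nat) :
  #|[pred k : 'I_N | reshape_index lam k == i]| = nth 0%N lam i.
Proof.
have lt (c : 'I_(nth 0%N lam i)) : (flatten_index lam i c < N)%N.
  by rewrite -lam_sum flatten_indexP.
pose f (c : 'I_(nth 0%N lam i)) : 'I_N := Ordinal (lt c).
have f_inj : injective f.
  move=> c c' /(congr1 val) /= /(congr1 (reshape_offset lam)).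
  by rewrite !flatten_indexKr // => /val_inj.
rewrite -[RHS]card_ord -(card_codom f_inj); apply: eq_card => k; rewrite !inE.
apply/eqP/codomP => [ki|[c ->]]; last by rewrite /= flatten_indexKl.
have lo : (reshape_offset lam k < nth 0%N lam i)%N.
  by rewrite -ki; apply: reshape_offsetP; rewrite lam_sum.
by exists (Ordinal lo); apply: val_inj; rewrite /= -ki reshape_indexK.
Qed.

Lemma hw_word_weight (i : 'I_n) :
  tenE i i (te C hw_word) = (nth 0%N lam i)%:R *: te C hw_word.
Proof.
rewrite tenE_te (eq_bigr (fun=> te C hw_word)) => [|k /eqP <-]; last by rewrite upd_id.
rewrite sumr_const scaler_nat -card_row; congr (_ *+ _); apply: eq_card => k.
by rewrite !inE unfold_in /= hw_wordE.
Qed.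

Definition tactL (s : 'S_N) : 'End(tensor) := linfun (tact s).

Lemma tactLE s t : tactL s t = tact s t.
Proof. exact: lfunE. Qed.

Definition specht_map (x : groupAlg C N) : tensor := actA tactL x (te C hw_word).

Lemma specht_mapE x : specht_map x = \sum_g acoef x g *: te C (precomp hw_word g).
Proof. by rewrite /specht_map actAE; apply: eq_bigr => g _; rewrite tactLE tact_te. Qed.

Fact specht_map_linear : linear specht_map.
Proof.
move=> a x y; rewrite !specht_mapE scaler_sumr -big_split /=.
by apply: eq_bigr => g _; rewrite acoefD acoefZ scalerDl scalerA.
Qed.

HB.instance Definition _ :=
  GRing.isLinear.Build C (groupAlg C N) tensor _ specht_map specht_map_linear.

Lemma specht_map_galg g : specht_map (galg C g) = te C (precomp hw_word g).
Proof.
rewrite specht_mapE (bigD1 g) //= acoef_galg eqxx scale1r big1 ?addr0 // => h /negPf hg.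
by rewrite acoef_galg hg scale0r.
Qed.

Lemma specht_map_mulr x g : specht_map (galg_mulr x g) = tact g (specht_map x).
Proof.
rewrite !specht_mapE linear_sum (reindex_inj (@mapcompI _ g)) /=.
apply: eq_bigr => s _; rewrite acoef_mulr mapcompKV linearZ /= tact_te.
by rewrite precomp_mapcomp.
Qed.

Lemma specht_map_E i j x :
  tenE i j (specht_map x) = \sum_g acoef x g *: tact g (tenE i j (te C hw_word)).
Proof.
rewrite /specht_map actAE linear_sum; apply: eq_bigr => g _ /=.
by rewrite linearZ /= tactLE tactE.
Qed.

Lemma row_group_precomp p : p \in row_group N lam -> precomp hw_word p = hw_word.
Proof.
rewrite inE => /forallP pR; apply/ffunP => x; apply: val_inj => /=.
by rewrite [precomp _ _ _]ffunE !hw_wordE; apply/eqP.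
Qed.

Local Notation c := (young_symmetrizer C N lam).

(** Row permutations fix [hw_word], so the row sum contributes a factor only. *)
Lemma specht_map_young : specht_map c =
  #|row_group N lam|%:R *:
    \sum_(q in col_group N lam) (-1) ^+ odd_perm q *: te C (precomp hw_word q).
Proof.
rewrite /young_symmetrizer linear_sum /=.
rewrite (eq_bigr (fun=> \sum_(q in col_group N lam)
  (-1) ^+ odd_perm q *: te C (precomp hw_word q))) => [|p pR].
  by rewrite sumr_const scaler_nat.
rewrite linear_sum; apply: eq_bigr => q qC /=.
by rewrite linearZ /= specht_map_galg -precomp_mapcomp row_group_precomp.
Qed.

Lemma row_col_group1 (q : 'S_N) :
  q \in col_group N lam -> precomp hw_word q = hw_word -> q = 1%g.
Proof.
rewrite inE => /forallP qC qR; apply/permP => x; rewrite perm1; apply: val_inj => /=.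
rewrite -(reshape_indexK lam (q x)) -[RHS](reshape_indexK lam) (eqP (qC x)).
by rewrite -!hw_wordE -[in RHS]qR [precomp _ _ _]ffunE.
Qed.

Lemma one_in_col_group : 1%g \in col_group N lam.
Proof. by rewrite inE; apply/forallP => x; rewrite perm1. Qed.

Lemma one_in_row_group : 1%g \in row_group N lam.
Proof. by rewrite inE; apply/forallP => x; rewrite perm1. Qed.

(** The coefficient at [hw_word] comes from q = 1 alone, because a column permutation that preserves
    all rows is trivial. *)
Lemma specht_map_young_neq0 : specht_map c <> 0.
Proof.
rewrite specht_map_young => /eqP; rewrite scaler_eq0 pnatr_eq0 => /orP[|/eqP].
  rewrite -leqn0 leqNgt; case/negP; apply/card_gt0P; exists 1%g.
  exact: one_in_row_group.
move=> /(congr1 (fun t : tensor => tcoef t hw_word)); rewrite tcoef0 tcoef_sum.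
rewrite (bigD1 1%g) ?one_in_col_group //= big1 ?addr0 => [|q /andP[qC q1]].
  rewrite tcoefZ mktensorE odd_perm1 expr0 mul1r.
  rewrite (_ : precomp _ _ = hw_word) ?eqxx; first by move/eqP; rewrite oner_eq0.
  by apply/ffunP => x; rewrite ffunE perm1.
rewrite tcoefZ mktensorE; case: eqP => [e|]; last by rewrite mulr0.
by rewrite (row_col_group1 qC (esym e)) eqxx in q1.
Qed.

(** The transposition of k and k' lies in the column group, reverses signs and fixes f, so the sum
    equals its own opposite. *)
Lemma col_antisym (f : word) (k k' : 'I_N) :
  k != k' -> f k = f k' -> reshape_offset lam k = reshape_offset lam k' ->
  \sum_(q in col_group N lam) (-1) ^+ odd_perm q *: te C (precomp f q) = 0.
Proof.
move=> kk' fk ok.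
have tO x : reshape_offset lam (tperm k k' x) = reshape_offset lam x.
  by case: tpermP => [->|->|].
set S := \sum_(_ in _) _; suff: S = - S.
  move/eqP; rewrite -addr_eq0 -mulr2n -scaler_nat scaler_eq0 pnatr_eq0 /=.
  by move/eqP.
rewrite {1}/S (reindex_inj (mulIg (tperm k k'))) /= /S -sumrN; apply: eq_big => q.
  rewrite !inE; apply: eq_forallb => x.
  by rewrite permM tO.
move=> qC; rewrite odd_permM odd_tperm kk' addbT signrN scaleNr.
congr (- (_ *: te C _)); apply/ffunP => x; rewrite !ffunE permM.
by case: tpermP => [->|->|].
Qed.

(** E_ij turns the letter j of some cell k into i. Row i is at least as long as row j, so it has a
    cell k' in the column of k; both now carry the letter i, and the signed column sum vanishes by
    [col_antisym]. *)
Lemma specht_map_young_raise (i j : 'I_n) : (i < j)%N -> tenE i j (specht_map c) = 0.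
Proof.
move=> ij; rewrite specht_map_young linearZ /= linear_sum /=.
rewrite (eq_bigr (fun q => \sum_(k | hw_word k == j)
   (-1) ^+ odd_perm q *: te C (precomp (upd hw_word k i) q))); last first.
  move=> q _; rewrite linearZ /= -tact_te -tactE tenE_te linear_sum scaler_sumr.
  by apply: eq_bigr => k _ /=; rewrite tact_te.
rewrite exchange_big big1 ?scaler0 // => k /eqP kj /=.
have kj' : reshape_index lam k = j by rewrite -kj hw_wordE.
have lo : (reshape_offset lam k < nth 0%N lam i)%N.
  apply: (@leq_trans (nth 0%N lam j)).
    by rewrite -kj'; apply: reshape_offsetP; rewrite lam_sum.
  have [jl|jl] := ltnP j (size lam); last by rewrite [X in (X <= _)%N]nth_default.
  case/and3P: lam_part => srt _ _.
  have gt : transitive geq by move=> y x z xy yz; exact: leq_trans yz xy.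
  have gr : reflexive geq by move=> x; exact: leqnn.
  suff : geq (nth 0%N lam i) (nth 0%N lam j) by [].
  have il : (i < size lam)%N by apply: ltn_trans jl.
  exact: (sorted_leq_nth gt gr 0%N srt i j il jl (ltnW ij)).
have ltk' : (flatten_index lam i (reshape_offset lam k) < N)%N.
  by rewrite -[X in (_ < X)%N]lam_sum flatten_indexP.
pose k' := Ordinal ltk'.
have k'i : reshape_index lam k' = i by rewrite /= flatten_indexKl.
have kk' : k != k'.
  apply/eqP => kk'; move: kj'; rewrite kk' k'i => eij.
  by rewrite eij ltnn in ij.
apply: (@col_antisym _ k k') => //.
  apply: val_inj; rewrite !ffunE eqxx eq_sym (negPf kk') /=.
  by rewrite flatten_indexKl.
by rewrite /= flatten_indexKr.
Qed.

Lemma specht_map_hwspace x : x \in specht C N lam -> specht_map x \in hwspace C n N lam.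
Proof.
suff: (specht C N lam <= linfun specht_map @^-1: hwspace C n N lam)%VS.
  by move=> /subvP h /h; rewrite -memv_preim lfunE.
apply/span_subvP => _ /imageP[g _ ->]; rewrite -memv_preim lfunE /= specht_map_mulr.
apply: hwspace_act; apply/mem_hwspace; split=> [i j ij|i].
  exact: specht_map_young_raise.
rewrite specht_map_E specht_mapE scaler_sumr; apply: eq_bigr => s _.
by rewrite hw_word_weight linearZ /= tact_te scalerA mulrC -scalerA.
Qed.

Lemma young_specht : c \in specht C N lam.
Proof.
apply: memv_span; apply/imageP; exists 1%g => //; apply/acoefP => g.
by rewrite acoef_mulr /mapcomp invg1 mul1g.
Qed.

Lemma specht_mulr x g : x \in specht C N lam -> galg_mulr x g \in specht C N lam.
Proof.
suff: (specht C N lam <= galgR C g @^-1: specht C N lam)%VS.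
  by move=> /subvP h /h; rewrite -memv_preim galgRE.
apply/span_subvP => _ /imageP[h _ ->]; rewrite -memv_preim galgRE galg_mulr_comp.
by apply: memv_span; apply/imageP; exists (mapcomp h g).
Qed.

(** The Specht module maps isomorphically and equivariantly both to S and to the highest weight
    vectors, so a has the same rank on the two. The map to tensors is injective since its kernel
    gives a stable subspace of the irreducible S and misses the Young symmetrizer; it is onto by
    [hwspace_minimal]. *)
Lemma dim_actA_specht (S : unitaryRightModule C N) (a : groupAlg C N) :
  ur_irreducible S -> corresponds_to S lam ->
  \dim (actA tactL a @: hwspace C n N lam) = \dim (limg (actA (Defs.ract S) a)).
Proof.
move=> [S0 Sirr] [phi [phiE phi_inj phi_full]].
set Sp := specht C N lam in phiE phi_inj phi_full.
pose psi := linfun specht_map.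
have psiE x : psi x = specht_map x by rewrite lfunE.
have phi_cap (X : {vspace groupAlg C N}) : (X <= Sp)%VS -> \dim (phi @: X) = \dim X.
  move=> XS; apply: limg_dim_eq; apply/eqP; rewrite -subv0; apply/subvP => x.
  move=> /memv_capP[xX]; rewrite memv_ker memv0 => /eqP x0; apply/eqP.
  by apply: phi_inj x0; apply: subvP xX.
have psi_ker : (Sp :&: lker psi = 0)%VS.
  have Kst g :
    (Defs.ract S g @: (phi @: (Sp :&: lker psi)) <= phi @: (Sp :&: lker psi))%VS.
    apply/subvP => _ /memv_imgP[_ /memv_imgP[x /memv_capP[xS xK] ->] ->].
    rewrite -phiE //; apply: memv_img; rewrite memv_cap specht_mulr //=.
    move: xK; rewrite !memv_ker !psiE specht_map_mulr => /eqP ->.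
    by rewrite linear0.
  case: (Sirr _ Kst) => [K0|Kfull].
    apply/eqP; rewrite -dimv_eq0 -phi_cap ?capvSl // K0 dimv0 //.
  have : (Sp :&: lker psi)%VS == Sp.
    by rewrite eqEdim capvSl /= -phi_cap // phi_full -Kfull phi_cap ?capvSl.
  move=> /eqP KS; have := young_specht; rewrite -/Sp -KS memv_cap => /andP[_].
  by rewrite memv_ker psiE => /eqP/specht_map_young_neq0.
have psi_cap (X : {vspace groupAlg C N}) : (X <= Sp)%VS -> \dim (psi @: X) = \dim X.
  move=> XS; apply: limg_dim_eq; apply/eqP; rewrite -subv0 -psi_ker.
  by rewrite capvS.
have psi_hw : (psi @: Sp)%VS = hwspace C n N lam.
  apply: hwspace_minimal.
  - by apply/subvP => _ /memv_imgP[x xS ->]; rewrite psiE specht_map_hwspace.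
  - move=> h0; have : psi c \in (psi @: Sp)%VS by rewrite memv_img // young_specht.
    by rewrite h0 memv0 psiE => /eqP/specht_map_young_neq0.
  - move=> s _ /memv_imgP[x xS ->]; rewrite psiE -specht_map_mulr -psiE.
    by rewrite memv_img // specht_mulr.
pose Ga := actA (galgR C (N := N)) a.
have GaE x : Ga x = \sum_g acoef a g *: galg_mulr x g.
  by rewrite /Ga actAE; apply: eq_bigr => g _; rewrite galgRE.
have GaS : (Ga @: Sp <= Sp)%VS.
  apply/subvP => _ /memv_imgP[x xS ->]; rewrite GaE.
  by apply: rpred_sum => g _; rewrite memvZ // specht_mulr.
transitivity (\dim (Ga @: Sp)).
  rewrite -psi_hw -(psi_cap _ GaS) -!limg_comp; congr (\dim _).
  apply: eq_in_limg => x xS; rewrite !comp_lfunE actAE GaE linear_sum.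
  by apply: eq_bigr => g _; rewrite linearZ /= !psiE specht_map_mulr tactLE.
rewrite -phi_full -(phi_cap _ GaS) -!limg_comp; congr (\dim _).
apply: eq_in_limg => x xS; rewrite !comp_lfunE GaE actAE linear_sum.
by apply: eq_bigr => g _; rewrite linearZ /= phiE.
Qed.

End SpechtTensor.


(** * The rank of F *)

Section GroupAlgebraProduct.

Variables (C : numClosedFieldType) (N : nat).

Implicit Types (a b x : groupAlg C N).

(** The product for right actions: a acts first, then b. *)
Definition amul a b : groupAlg C N := \sum_g acoef b g *: galg_mulr a g.

Definition asum (A : {set 'S_N}) : groupAlg C N := \sum_(g in A) galg C g.

Variables (V : vectType C) (act : 'S_N -> 'End(V)).
Hypothesis act_comp : forall g h v, act (mapcomp g h) v = act h (act g v).

Fact acoef_sum (I : Type) (r : seq I) (P : pred I) (F : I -> groupAlg C N) g :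
  acoef (\sum_(i <- r | P i) F i) g = \sum_(i <- r | P i) acoef (F i) g.
Proof. by elim/big_rec2: _ => [|i x y _ <-]; rewrite ?acoef0 ?acoefD. Qed.

Lemma actA_mulr a g v : actA act (galg_mulr a g) v = act g (actA act a v).
Proof.
rewrite !actAE linear_sum (reindex_inj (@mapcompI _ g)) /=.
by apply: eq_bigr => s _; rewrite acoef_mulr mapcompKV linearZ /= act_comp.
Qed.

Lemma actA_amul a b v : actA act (amul a b) v = actA act b (actA act a v).
Proof.
rewrite [RHS]actAE; under [RHS]eq_bigr => g _ do rewrite -actA_mulr actAE scaler_sumr.
rewrite exchange_big actAE; apply: eq_bigr => s _ /=.
rewrite /amul acoef_sum scaler_suml; apply: eq_bigr => g _.
by rewrite acoefZ scalerA.
Qed.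

Lemma actA_lin c a b v : actA act (c *: a + b) v = c *: actA act a v + actA act b v.
Proof.
rewrite !actAE scaler_sumr -big_split /=; apply: eq_bigr => g _.
by rewrite acoefD acoefZ scalerDl scalerA.
Qed.

Lemma actA_galg g v : actA act (galg C g) v = act g v.
Proof.
rewrite actAE (bigD1 g) //= acoef_galg eqxx scale1r big1 ?addr0 // => h /negPf hg.
by rewrite acoef_galg hg scale0r.
Qed.

Lemma actA_asum (A : {set 'S_N}) v : actA act (asum A) v = \sum_(g in A) act g v.
Proof.
rewrite actAE [RHS]big_mkcond; apply: eq_bigr => g _; rewrite acoef_sum.
case: ifP => gA; last first.
  rewrite big1 ?scale0r // => h hA; rewrite acoef_galg; case: eqP => // gh.
  by rewrite gh hA in gA.
rewrite (bigD1 g) //= acoef_galg eqxx big1 ?addr0 ?scale1r // => h /andP[_ /negPf hg].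
by rewrite acoef_galg eq_sym hg.
Qed.

Variable K : {group 'S_N}.

Lemma actA_asum_fixed v : (forall g, g \in K -> act g v = v) ->
  actA act (asum K) v = #|K|%:R *: v.
Proof.
by move=> vK; rewrite actA_asum (eq_bigr (fun=> v)) // sumr_const scaler_nat.
Qed.

Lemma act_actA_asum h v : h \in K -> act h (actA act (asum K) v) = actA act (asum K) v.
Proof.
move=> hK; rewrite !actA_asum linear_sum [RHS](reindex_inj (mulgI h)) /=.
apply: eq_big => g; first by rewrite groupMl.
by rewrite -act_comp.
Qed.

End GroupAlgebraProduct.

(** * Compression of an operator to the K-invariant vectors *)

Section UnitaryRank.

Variables (C : numClosedFieldType) (N : nat) (S : unitaryRightModule C N).
Variables (K : {group 'S_N}) (d : nat) (e : seq S) (a : groupAlg C N).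
Hypothesis e_orth : orthonormal (ur_dot S) e.
Hypothesis e_fix : <<take d e>>%VS = fixed_vectors S K.

Local Notation dot := (ur_dot S).
Local Notation act := (actA (Defs.ract S)).
Local Notation FV := (fixed_vectors S K).

Let F : 'M[C]_d := \matrix_(i, j) dot (act a e`_i) e`_j.

Let theta (r : 'rV[C]_d) : S := \sum_i r 0 i *: e`_i.

Fact theta_linear : linear theta.
Proof.
move=> c x y; rewrite /theta scaler_sumr -big_split /=; apply: eq_bigr => i _.
by rewrite !mxE scalerDl scalerA.
Qed.

HB.instance Definition _ :=
  GRing.isLinear.Build C 'rV[C]_d S _ theta theta_linear.

Lemma mem_fixed_vectors v : v \in FV <-> forall g, g \in K -> Defs.ract S g v = v.
Proof.
split=> [/subv_bigcapP vK g /vK|vK].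
  by rewrite -memvE => /fixedSpaceP.
by apply/subv_bigcapP => g gK; rewrite -memvE; apply/fixedSpaceP/vK.
Qed.

(** Past the end of [e] the entry is the default value 0, hence the condition [j < size e]. *)
Lemma e_dot i j : dot e`_i e`_j = ((i == j) && (j < size e)%N)%:R.
Proof.
have [uniqe dote] := orthonormalP e_orth.
have [je|je] := ltnP j (size e); last by rewrite (nth_default _ je) linear0r andbF.
have [ie|ie] := ltnP i (size e); last first.
  rewrite (nth_default _ ie) linear0l andbT; case: eqP => // ij.
  by rewrite ij leqNgt je in ie.
by rewrite dote ?mem_nth // nth_uniq // andbT.
Qed.

Lemma theta_dot r (j : 'I_d) : dot (theta r) e`_j = (r 0 j) * (j < size e)%N%:R.
Proof.
rewrite linear_sumlz (bigD1 j) //= big1 => [|i ij]; last first.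
  by rewrite linearZl_LR /= e_dot val_eqE (negPf ij) mulr0.
by rewrite linearZl_LR /= e_dot eqxx addr0.
Qed.

Lemma theta_FV r : theta r \in FV.
Proof.
rewrite -e_fix; apply: rpred_sum => i _; apply: memvZ.
have [ie|ie] := ltnP i (size e); last by rewrite nth_default // mem0v.
apply: memv_span; rewrite -(nth_take 0 (ltn_ord i)); apply: mem_nth.
by rewrite size_take_min leq_min ltn_ord ie.
Qed.

Lemma FV_theta v : v \in FV -> exists r, v = theta r.
Proof.
rewrite -e_fix => ve; suff: v \in limg (linfun theta).
  by case/memv_imgP => r _ ->; exists r; rewrite lfunE.
apply: subvP ve; apply/span_subvP => x xe.
have := xe; rewrite -index_mem size_take_min leq_min => /andP[id ie].
rewrite -[x](nth_index 0 xe); move: (index _ _) id ie => i id ie; rewrite nth_take //.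
apply/memv_imgP; exists (delta_mx 0 (Ordinal id)); first exact: memvf.
rewrite lfunE /= /theta (bigD1 (Ordinal id)) //= mxE !eqxx scale1r.
by rewrite big1 ?addr0 // => j /negPf jd; rewrite mxE jd andbF scale0r.
Qed.

Local Notation kappa := (act (asum C K)).

Lemma ract_compE g h v :
  Defs.ract S (mapcomp g h) v = Defs.ract S h (Defs.ract S g v).
Proof. exact: ract_comp. Qed.

Lemma kappa_fixed v : v \in FV -> kappa v = #|K|%:R *: v.
Proof. by move=> /mem_fixed_vectors vK; apply: actA_asum_fixed. Qed.

Lemma kappa_FV v : kappa v \in FV.
Proof. by apply/mem_fixed_vectors => g gK; apply: (act_actA_asum ract_compE). Qed.

(** By invariance <y.g, kappa y> = <y, (kappa y).g^-1>, and the second argument is K-invariant; so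
    <kappa y, kappa y> = 0. *)
Lemma kappa_orth y : (forall v, v \in FV -> dot y v = 0) -> kappa y = 0.
Proof.
move=> yFV; apply/eqP; rewrite -(dnorm_eq0 dot) {1}actA_asum linear_sumlz.
apply/eqP; rewrite big1 // => g gK.
rewrite -[LHS](@ur_dot_invariant _ _ S g^-1) -!ract_compE /mapcomp mulVg ract1 id_lfunE.
apply: yFV; apply/mem_fixed_vectors => h hK.
by rewrite !(act_actA_asum ract_compE) ?groupV.
Qed.

(** As kappa is |K| times the orthogonal projection onto the invariants, F is the matrix of the
    compression of a, acting on row vectors. *)
Lemma kappa_act_theta r : kappa (act a (theta r)) = #|K|%:R *: theta (r *m F).
Proof.
have [-> ->] : theta r = \sum_i r 0 i *: e`_i /\
    theta (r *m F) = \sum_i r 0 i *: theta (row i F).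
  split=> //; rewrite mulmx_sum_row linear_sum.
  by apply: eq_bigr => i _; rewrite linearZ.
rewrite !linear_sum; apply: eq_bigr => i _ /=.
rewrite !linearZ /=; congr (_ *: _).
rewrite -(subrK (theta (row i F)) (act a e`_i)) linearD /=.
rewrite (kappa_fixed (theta_FV _)) kappa_orth ?add0r // => v /FV_theta[u ->].
rewrite linear_sumr big1 // => j _; rewrite linearZr_LR /= linearBl /=.
rewrite theta_dot !mxE; case: ltnP => je; first by rewrite mulr1 subrr mulr0.
by rewrite (nth_default _ je) linear0r mulr0 subrr mulr0.
Qed.

(** The image is that of the row space of F under [theta]. A basis of the row space parametrizes it
    injectively by \rank F coordinates. *)
Lemma dim_limg_rank :
  \dim (limg (act (amul (amul (asum C K) a) (asum C K)))) = \rank F.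
Proof.
have K0 : #|K|%:R != 0 :> C by rewrite pnatr_eq0 -lt0n cardG_gt0.
set A := act _.
have AE v : A v = kappa (act a (kappa v)).
  by rewrite /A !(actA_amul ract_compE).
pose B := linfun (theta \o mulmxr (row_base F)).
have BE s : B s = theta (s *m row_base F) by rewrite lfunE.
have -> : limg A = limg B.
  apply/eqP; rewrite eqEsubv; apply/andP; split; apply/subvP => _ /memv_imgP[v _ ->].
    have [r vr] := FV_theta (kappa_FV v).
    rewrite AE vr kappa_act_theta memvZ //.
    have /submxP[s ->] : (r *m F <= row_base F)%MS by rewrite eq_row_base submxMl.
    by rewrite -BE memv_img ?memvf.
  have /submxP[r rF] : (v *m row_base F <= F)%MS.
    by rewrite (submx_trans (submxMl _ _)) ?eq_row_base.
  (* Each of the two factors kappa contributes |K|, hence the normalization |K|^-2. *)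
  rewrite BE rF (_ : theta _ = A ((#|K|%:R ^- 2) *: theta r)).
    by rewrite memv_img ?memvf.
  rewrite AE !linearZ /= (kappa_fixed (theta_FV _)) !linearZ /= kappa_act_theta.
  by rewrite !scalerA mulrAC -expr2 divff ?scale1r // expf_neq0.
rewrite limg_dim_eq; first by rewrite dimvf dim_matrix mul1r.
apply/eqP; rewrite -subv0; apply/subvP => s /memv_capP[_].
rewrite memv_ker memv0 BE => /eqP s0; suff: s *m row_base F = 0.
  move=> /(congr1 (mulmx^~ (pinvmx (row_base F)))).
  by rewrite mulmxKp ?row_base_free // mul0mx => ->.
have /submxP[r rF] : (s *m row_base F <= F)%MS.
  by rewrite (submx_trans (submxMl _ _)) ?eq_row_base.
apply/rowP => j; rewrite [RHS]mxE.
have := theta_dot (s *m row_base F) j; rewrite s0 linear0l.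
case: ltnP => je; first by rewrite mulr1 => <-.
(* Past the end of [e] the columns of F are zero. *)
move=> _; rewrite rF mxE big1 // => i _.
by rewrite mxE (nth_default _ je) linear0r mulr0.
Qed.

End UnitaryRank.


(** * From tensors to polynomials *)

Section CycleStatistic.

Variable m : nat.

Lemma nu_porbits (g : 'S_m) : nu g = (\sum_(c in porbits g) (#|c| - 1))%N.
Proof.
rewrite /nu (eq_bigr (fun i =>
  \sum_(c in porbits g) (i - 1) * (#|c| == i)))%N; last first.
  move=> i _; rewrite -big_distrr /=; congr (_ * _)%N.
  rewrite /cycle_mult -sum1dep_card big_mkcondr /=.
  by apply: eq_bigr => c _; case: eqP.
rewrite exchange_big; apply: eq_bigr => c /imsetP[x _ ->] /=.
have c1 : (1 <= #|porbit g x| < m.+1)%N.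
  apply/andP; split; first by apply/card_gt0P; exists x; apply: porbit_id.
  by rewrite ltnS; apply: leq_trans (max_card _) _; rewrite card_ord.
rewrite (bigD1_seq #|porbit g x|) ?iota_uniq ?mem_index_iota //= eqxx muln1.
by rewrite big1 ?addn0 // => i /negPf; rewrite eq_sym => ->; rewrite muln0.
Qed.

(* Each cycle c is counted as |c| - 1 = \sum_(x in c) (1 - 1 / |c|). *)
Lemma nu_sum (g : 'S_m) :
  (nu g)%:R = \sum_(x < m) (1 - #|porbit g x|%:R^-1) :> rat.
Proof.
rewrite nu_porbits natr_sum (partition_big (porbit g) (mem (porbits g))) /=; last first.
  by move=> x _; apply: imset_f.
apply: eq_bigr => c /imsetP[x _ ->].
have cx : #|porbit g x| != 0%N.
  by rewrite -lt0n; apply/card_gt0P; exists x; apply: porbit_id.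
rewrite (eq_bigl (mem (porbit g x))) => [|y /=]; last first.
  by rewrite eq_porbit_mem.
rewrite (eq_bigr (fun=> 1 - #|porbit g x|%:R^-1)) => [|y]; last first.
  by rewrite inE -eq_porbit_mem => /eqP ->.
rewrite sumr_const mulrnBl -[_^-1 *+ _]mulr_natr mulVf ?pnatr_eq0 //.
by rewrite natrB // lt0n.
Qed.

End CycleStatistic.

(** * The map from tensors to polynomials and the cyclic module *)

Section Polynomials.

Variables (C : numClosedFieldType) (n l : nat).
Hypothesis l_gt0 : (0 < l)%N.

Local Notation N := (n * l)%N.
Local Notation tensor := (tensor C n N).
Local Notation word := (word n N).
Local Notation poly := {mpoly C[n * n]}.
Local Notation X := (genericX C n).

Lemma blk_lt (k : 'I_N) : (k %/ l < n)%N.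
Proof. by rewrite ltn_divLR. Qed.

Definition blk (k : 'I_N) : 'I_n := Ordinal (blk_lt k).

Lemma res_lt (k : 'I_N) : (k %% l < l)%N.
Proof. exact: ltn_pmod. Qed.

Definition res (k : 'I_N) : 'I_l := Ordinal (res_lt k).

Lemma pos_lt (i : 'I_n) (j : 'I_l) : (i * l + j < N)%N.
Proof.
apply: (@leq_trans (i.+1 * l)); first by rewrite mulSn addnC ltn_add2r.
by rewrite leq_mul2r ltn_ord orbT.
Qed.

Definition pos (i : 'I_n) (j : 'I_l) : 'I_N := Ordinal (pos_lt i j).

Lemma blk_pos i j : blk (pos i j) = i.
Proof. by apply: val_inj; rewrite /= divnMDl // divn_small ?addn0. Qed.

Lemma res_pos i j : res (pos i j) = j.
Proof. by apply: val_inj; rewrite /= modnMDl modn_small. Qed.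

Lemma posK k : pos (blk k) (res k) = k.
Proof. by apply: val_inj; rewrite /= -divn_eq. Qed.

Lemma big_pos (R : Type) (idx : R) (op : Monoid.com_law idx) (F : 'I_N -> R) :
  \big[op/idx]_k F k = \big[op/idx]_j \big[op/idx]_i F (pos i j).
Proof.
rewrite pair_bigA /= (reindex (fun p : 'I_l * 'I_n => pos p.2 p.1)) //=.
exists (fun k => (res k, blk k)) => [[j i] _|k _] /=.
  by rewrite res_pos blk_pos.
exact: posK.
Qed.

Definition wmon (f : word) : poly := \prod_k X (f k) (blk k).

Definition pol (t : tensor) : poly := \sum_f tcoef t f *: wmon f.

Fact pol_linear : linear pol.
Proof.
move=> a t u; rewrite /pol scaler_sumr -big_split /=; apply: eq_bigr => f _.
by rewrite tcoefD tcoefZ scalerDl scalerA.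
Qed.

HB.instance Definition _ := GRing.isLinear.Build C tensor poly _ pol pol_linear.

Lemma pol_te f : pol (te C f) = wmon f.
Proof.
rewrite /pol (bigD1 f) //= mktensorE eqxx scale1r big1 ?addr0 // => g /negPf gf.
by rewrite mktensorE gf scale0r.
Qed.

Lemma polEM i j (p q : poly) : polE i j (p * q) = polE i j p * q + p * polE i j q.
Proof.
rewrite /polE mulr_suml mulr_sumr -big_split /=; apply: eq_bigr => s _.
by rewrite mderivM mulrDr !mulrA [p * genericX _ _ _ _]mulrC.
Qed.

Lemma polE_X i j a b : polE i j (X a b) = (a == j)%:R * X i b.
Proof.
rewrite /polE (bigD1 b) // big1 => [|s /negPf sb]; last first.
  by rewrite mderiv_genericX [b == s]eq_sym sb andbF mulr0.
by rewrite mderiv_genericX eqxx andbT [LHS]addr0 mulrC.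
Qed.

Lemma polE1 (i j : 'I_n) : polE i j (1 : poly) = 0.
Proof.
have := polEM i j 1 1; rewrite !mul1r mulr1 => /esym/eqP.
by rewrite -subr_eq0 addrK => /eqP.
Qed.

(** The Leibniz rule; uniqueness of the indices makes [k' != k] drop exactly one factor. *)
Lemma polE_prod i j (I : eqType) (r : seq I) (F : I -> poly) : uniq r ->
  polE i j (\prod_(k <- r) F k) =
  \sum_(k <- r) polE i j (F k) * \prod_(k' <- r | k' != k) F k'.
Proof.
elim: r => [|x r IH] /=; first by rewrite !big_nil polE1.
case/andP=> xr ur; rewrite !big_cons polEM IH // eqxx /=; congr (_ * _ + _).
  rewrite [RHS]big_seq_cond big_seq; apply: eq_bigl => k.
  by case kr: (k \in r) => //=; apply/esym; apply: contraNneq xr => <-.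
rewrite mulr_sumr; apply: eq_big_seq => k kr.
rewrite big_cons ifT; first by rewrite mulrCA.
by apply: contraNneq xr => ->.
Qed.

Lemma pol_E i j t : pol (tenE i j t) = polE i j (pol t).
Proof.
rewrite [in LHS](tensor_expand t) !linear_sum; apply: eq_bigr => f _ /=.
rewrite !linearZ /=; congr (_ *: _); rewrite tenE_te linear_sum /=.
rewrite /wmon polE_prod ?index_enum_uniq // big_mkcond; apply: eq_bigr => k _ /=.
rewrite polE_X; case: eqP => fk; last by rewrite !mul0r.
rewrite mul1r pol_te /wmon (bigD1 k) //= ffunE eqxx; congr (_ * _).
by apply: eq_bigr => k' /negPf kk'; rewrite ffunE kk'.
Qed.

Definition wexp (f : word) : 'X_{1.. n * n} :=
  (\sum_k U_(mxvec_index (f k) (blk k)))%MM.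

Lemma wmonE f : wmon f = 'X_[wexp f].
Proof.
rewrite /wmon /wexp; elim/big_rec2: _ => [|k m p _ ->]; first by rewrite mpolyX0.
by rewrite mpolyXD mxE.
Qed.

Lemma wexpE f a b :
  wexp f (mxvec_index a b) = count_mem (a, b) [tuple (f k, blk k) | k < N].
Proof.
rewrite /wexp mnm_sumE count_map -sum1_count [RHS]big_mkcond val_ord_tuple big_enum /=.
apply: eq_bigr => k _; rewrite mnm1E /mxvec_index (inj_eq (@cast_ord_inj _ _ _)).
by rewrite (inj_eq enum_rank_inj); case: eqP.
Qed.

Lemma row_group_set : group_set (rect_row_group N l).
Proof.
apply/group_setP; split; first by rewrite inE; apply/forallP => x; rewrite perm1.
move=> g h; rewrite !inE => /forallP gK /forallP hK; apply/forallP => x.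
by rewrite permM (eqP (hK _)).
Qed.

Definition rowK : {group 'S_N} := Group row_group_set.

Lemma mem_rowK g : (g \in rowK) = [forall k, blk (g k) == blk k].
Proof. by rewrite inE; apply: eq_forallb => k; rewrite -val_eqE. Qed.

(** Equal exponents mean equal multisets of pairs (letter, block). The permutation matching the two
    lists preserves blocks, so it lies in K. *)
Lemma wexp_inj f g : wexp f = wexp g -> exists2 s, s \in rowK & g = precomp f s.
Proof.
move=> fg; have /tuple_permP[s sE] :
    perm_eq [tuple (g k, blk k) | k < N] [tuple (f k, blk k) | k < N].
  by apply/allP => -[a b] _ /=; rewrite -!wexpE fg.
have {}sE k : (g k, blk k) = (f (s k), blk (s k)).
  have := congr1 (fun u => nth (g k, blk k) u k) sE.
  by rewrite -!tnth_nth !tnth_mktuple.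
exists s; last by apply/ffunP => k; rewrite ffunE; have /(congr1 fst) := sE k.
by rewrite mem_rowK; apply/forallP => k; apply/eqP; have /(congr1 snd) := sE k.
Qed.

(** The words sharing a monomial are related by K, so an invariant t has one coefficient on all of
    them, and the monomial appears with a positive multiple of it. *)
Lemma pol_inj t : (forall s, s \in rowK -> tact s t = t) -> pol t = 0 -> t = 0.
Proof.
move=> tK pt0; apply/tensorP => f; rewrite tcoef0.
have := congr1 (mcoeff (wexp f)) pt0; rewrite mcoeff0 raddf_sum /=.
rewrite (bigID (fun g => wexp g == wexp f)) /=.
rewrite [X in _ + X]big1 ?addr0 => [|g gf]; last first.
  by rewrite mcoeffZ wmonE mcoeffX (negPf gf) mulr0.
rewrite (eq_bigr (fun=> tcoef t f)) => [|g /eqP gf]; last first.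
  rewrite mcoeffZ wmonE mcoeffX gf eqxx mulr1.
  have [s sK ->] := wexp_inj (esym gf).
  by rewrite -{1}(tK s sK) mktensorE precompK.
rewrite sumr_const => /eqP; rewrite mulrn_eq0 => /orP[|/eqP //].
by rewrite -leqn0 leqNgt => /negP[]; apply/card_gt0P; exists f; apply: eqxx.
Qed.

Lemma pol_tact s t : s \in rowK -> pol (tact s t) = pol t.
Proof.
rewrite mem_rowK => /forallP sK; rewrite [in LHS](tensor_expand t) !linear_sum.
apply: eq_bigr => f _ /=; rewrite !linearZ /= tact_te pol_te; congr (_ *: _).
rewrite /wmon [RHS](reindex_inj (@perm_inj _ s)) /=; apply: eq_bigr => k _.
by rewrite ffunE (eqP (sK k)).
Qed.

Local Notation act := (actA (tactL C n (N := N))).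
Local Notation kappa := (asum C rowK).

Lemma tactL_comp (g h : 'S_N) (t : tensor) :
  tactL C n (mapcomp g h) t = tactL C n h (tactL C n g t).
Proof. by rewrite !tactLE tact_comp. Qed.

Lemma pol_kappa t : pol (act kappa t) = #|rowK|%:R *: pol t.
Proof.
rewrite actA_asum linear_sum (eq_bigr (fun=> pol t)) => [|s sK].
  by rewrite sumr_const scaler_nat.
by rewrite /= tactLE pol_tact.
Qed.

Lemma tactA_E i j b t : act b (tenE i j t) = tenE i j (act b t).
Proof.
rewrite !actAE linear_sum; apply: eq_bigr => g _ /=.
by rewrite linearZ /= !tactLE tactE.
Qed.

Definition base_word : word := [ffun k => blk k].

Local Notation w := (te C base_word).

Lemma precomp_base s : (precomp base_word s == base_word) = (s \in rowK).
Proof.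
rewrite mem_rowK; apply/eqP/forallP => [/ffunP sw k|sK].
  by have := sw k; rewrite !ffunE => ->.
by apply/ffunP => k; rewrite !ffunE (eqP (sK k)).
Qed.

Lemma kappa_base : act kappa w = #|rowK|%:R *: w.
Proof.
apply: actA_asum_fixed => g gK; rewrite tactLE tact_te.
by have := gK; rewrite -precomp_base => /eqP ->.
Qed.

(** K is the stabilizer of [base_word]. Thus the enveloping algebra takes w to every [te f]
    multiplied by kappa. *)
Lemma orbop_base f : orbop f base_word w = act kappa (te C f).
Proof.
rewrite actA_asum [RHS]big_mkcond; apply: eq_bigr => s _.
rewrite mktensorE precomp_base; case: ifP => _; rewrite ?scale1r ?scale0r //.
by rewrite tactLE tact_te.
Qed.

(** The generator is in the image because kappa multiplies w by |K| and is absorbed by [pol] up to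
    |K|. Conversely every tensor multiplied by kappa is reached from w by the enveloping algebra. *)
Lemma cyclic_pol (b : groupAlg C N) (y : polyMat C n) :
  cyclic_submodule (pol (act b w) : polyMat C n) y <->
  exists2 t, t \in limg (act (amul (amul kappa b) kappa)) & pol t = y.
Proof.
have K0 : #|rowK|%:R != 0 :> C by rewrite pnatr_eq0 -lt0n cardG_gt0.
have AE t : act (amul (amul kappa b) kappa) t = act kappa (act b (act kappa t)).
  by rewrite !(actA_amul tactL_comp).
split.
- move=> /(_ (fun y => exists2 t, t \in limg (act (amul (amul kappa b) kappa))
     & pol t = y)); apply; last first.
    exists (act (amul (amul kappa b) kappa) (#|rowK|%:R ^- 2 *: w)).
      by rewrite memv_img ?memvf.
    rewrite AE pol_kappa !linearZ /= kappa_base !linearZ /= !scalerA.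
    by rewrite -expr2 divff ?scale1r // expf_neq0.
  split.
  + by exists 0; rewrite ?mem0v ?linear0.
  + move=> a _ _ [t tU <-] [u uU <-]; exists (a *: t + u).
      by rewrite memvD ?memvZ.
    exact: linearP.
  + move=> i j _ [_ /memv_imgP[t _ ->] <-].
    exists (tenE i j (act (amul (amul kappa b) kappa) t)); last by rewrite pol_E.
    by rewrite -tactA_E memv_img ?memvf.
- move=> [_ /memv_imgP[t _ ->] <-] W Wsub Ww.
  (* Pulled back to tensors, W becomes a submodule containing w, hence is closed under the operators
     [orbop f base_word]; by linearity it suffices to reach the basis tensors. *)
  have sub : submodule (M := tensorModule C n N)
      (fun u => W (pol (act (amul (amul kappa b) kappa) u))).
    case: Wsub => W0 Wlin WE; split; first by rewrite !linear0.
      by move=> a u v Wu Wv; rewrite !linearP; apply: Wlin.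
    by move=> i j u Wu; rewrite tactA_E pol_E; apply: WE.
  have Wb : W (pol (act (amul (amul kappa b) kappa) w)).
    rewrite AE kappa_base pol_kappa !linearZ /=.
    by do 2!apply: (@submodule_scale _ _ (polyMat C n) W _ _ Wsub).
  suff Wf f : W (pol (act (amul (amul kappa b) kappa) (te C f))).
    rewrite (tensor_expand t) !linear_sum; apply: (submodule_sum Wsub) => f _ /=.
    rewrite !linearZ; apply: (@submodule_scale _ _ (polyMat C n) W _ _ Wsub).
    exact: Wf.
  have := env_submodule sub (orbop_env C f base_word) Wb.
  rewrite orbop_base (_ : pol _ =
    #|rowK|%:R *: pol (act (amul (amul kappa b) kappa) (te C f))).
    move=> /(submodule_scale (#|rowK|%:R^-1) Wsub).
    by rewrite scalerA mulVf // scale1r.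
  (* The additional kappa in [orbop_base] costs only a scalar. *)
  have KK t' : act kappa (act kappa t') = #|rowK|%:R *: act kappa t'.
    by apply: actA_asum_fixed => g gK; apply: (act_actA_asum tactL_comp).
  by rewrite !AE KK !linearZ.
Qed.

(** F j permutes the j-th column of the n by l array; this identifies H with a product of l copies
    of the symmetric group of degree n. *)
Definition colfun (F : {ffun 'I_l -> 'S_n}) (k : 'I_N) : 'I_N :=
  pos (F (res k) (blk k)) (res k).

Lemma colfun_inj F : injective (colfun F).
Proof.
move=> k k' e; have er : res k = res k'.
  by have := congr1 res e; rewrite !res_pos.
have := congr1 blk e; rewrite !blk_pos er => /perm_inj eb.
by rewrite -(posK k) -(posK k') er eb.
Qed.

Definition colperm F : 'S_N := perm (@colfun_inj F).

Lemma colperm_pos F i j : colperm F (pos i j) = pos (F j i) j.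
Proof. by rewrite permE /colfun res_pos blk_pos. Qed.

Lemma colperm_inj : injective colperm.
Proof.
move=> F G FG; apply/ffunP => j; apply/permP => i.
have := congr1 (fun s : 'S_N => blk (s (pos i j))) FG.
by rewrite /= !colperm_pos !blk_pos.
Qed.

Lemma mem_colK h : (h \in rect_col_group N l) = [forall k, res (h k) == res k].
Proof. by rewrite inE; apply: eq_forallb => k; rewrite -val_eqE. Qed.

Lemma colK_image : rect_col_group N l = [set colperm F | F in setT].
Proof.
apply/setP => h; rewrite mem_colK; apply/forallP/imsetP => [hH|[F _ ->] k]; last first.
  by rewrite permE res_pos.
have hinj j : injective (fun i => blk (h (pos i j))).
  move=> i i' e; have := posK (h (pos i j)).
  rewrite (eqP (hH _)) res_pos e -[X in pos _ X](res_pos i' j) -(eqP (hH _)) posK.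
  by move=> /perm_inj /(congr1 blk); rewrite !blk_pos.
exists [ffun j => perm (hinj j)] => //; apply/permP => k.
by rewrite permE /colfun ffunE permE posK -[in RHS](eqP (hH k)) posK.
Qed.

Lemma colperm_porbit F i j :
  #|porbit (colperm F) (pos i j)| = #|porbit (F j) i|.
Proof.
have posj_inj : injective (pos^~ j).
  by move=> x y /(congr1 blk); rewrite !blk_pos.
rewrite -(card_imset _ posj_inj); apply: eq_card => y.
have powE m : (colperm F ^+ m)%g (pos i j) = pos ((F j ^+ m)%g i) j.
  by elim: m => [|m IH]; rewrite ?expg0 ?perm1 // !expgSr !permM IH colperm_pos.
apply/porbitP/imsetP => [[m ->]|[_ /porbitP[m ->] ->]].
  by exists ((F j ^+ m)%g i); rewrite ?powE // mem_porbit.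
by exists m; rewrite powE.
Qed.

(** By [nu_sum], nu is a sum over points of a function of the orbit size, and every orbit stays
    within one column. *)
Lemma nu_colperm F : nu (colperm F) = (\sum_j nu (F j))%N.
Proof.
apply/eqP; rewrite -(@eqr_nat rat) nu_sum natr_sum big_pos; apply/eqP.
by apply: eq_bigr => j _; rewrite nu_sum; apply: eq_bigr => i _; rewrite colperm_porbit.
Qed.

Variable alpha : C.

Definition col_alpha : groupAlg C N :=
  \sum_(h in rect_col_group N l) alpha ^+ nu h *: galg C h.

Lemma actA_col_alpha (V : vectType C) (a : 'S_N -> 'End(V)) v :
  actA a col_alpha v = \sum_(h in rect_col_group N l) alpha ^+ nu h *: a h v.
Proof.
rewrite /col_alpha; elim/big_rec2: _ => [|h x y _ <-].
  by rewrite actAE big1 // => g _; rewrite acoef0 scale0r.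
by rewrite actA_lin actA_galg.
Qed.

(** Expanding the l-th power by distributivity gives a sum over families of l permutations, that is,
    over H; the exponents of alpha add up by [nu_colperm]. *)
Lemma pol_alpha_det : pol (act col_alpha w) = alpha_det alpha X ^+ l.
Proof.
rewrite actA_col_alpha linear_sum /= colK_image big_imset /=; last first.
  by move=> F G _ _; apply: colperm_inj.
transitivity (\prod_(j < l) alpha_det alpha X); last by rewrite prodr_const card_ord.
rewrite /alpha_det bigA_distr_bigA /=; apply: eq_big => [F|F _]; first by rewrite inE.
rewrite linearZ /= tactLE tact_te pol_te nu_colperm scaler_prod.
rewrite -prodrXr; congr (_ *: _); rewrite /wmon big_pos.
apply: eq_bigr => j _; apply: eq_bigr => i _.
by rewrite !ffunE colperm_pos !blk_pos.
Qed.

End Polynomials.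

(** * The multiplicity as the rank of F *)

Theorem theorem2p5 (R : realType) (n l : nat) (n_gt0 : (0 < n)%N)
    (l_gt0 : (0 < l)%N) (alpha : R[i]) (lam : seq nat)
    (lam_part : is_partition lam (n * l)) (lam_size : (size lam <= n)%N)
    (M : glModule R[i] n) (M_lam : irreducible_of_highest_weight M lam)
    (S : unitaryRightModule R[i] (n * l)) (S_irr : ur_irreducible S)
    (S_lam : corresponds_to S lam) (e : seq S)
    (e_basis : adapted_basis (rect_row_group (n * l) l) (kostka lam (nseq n l)) e) :
  has_multiplicity M
    (cyclic_submodule
       (alpha_det alpha (genericX R[i] n) ^+ l : polyMat R[i] n))
    (\rank (Fmatrix alpha e (kostka lam (nseq n l)))).
Proof.
case: e_basis => _ e_orth e_fix _.
set d := kostka _ _ in e_fix *; set K := rowK n l.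
set b := col_alpha n l alpha.
set a := amul (amul (asum _ K) b) (asum _ K).
set rho := actA (tactL R[i] n (N := n * l)) a.
have -> : Fmatrix alpha e d = \matrix_(i, j) ur_dot S (actA (Defs.ract S) b e`_i) e`_j.
  apply/matrixP => i j; rewrite !mxE actA_col_alpha linear_sumlz.
  by apply: eq_bigr => h _; rewrite linearZl_LR.
(* The rank of F becomes the rank of a on S, then the dimension of the image under rho of the
   highest weight vectors, and finally that of the highest weight vectors in the image of rho. *)
rewrite -(dim_limg_rank (K := K) b e_orth e_fix) -/a.
rewrite -(dim_actA_specht lam_part lam_size a S_irr S_lam) -/rho.
have rhoE i j t : rho (tenE i j t) = tenE i j (rho t) by apply: tactA_E.
rewrite -(hwspace_img lam rhoE).
have -> : cyclic_submodule (alpha_det alpha (genericX R[i] n) ^+ l : polyMat R[i] n)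
    = (fun y => exists2 t, t \in limg rho & pol l_gt0 t = y).
  apply/funext => y; apply/propext; rewrite -(pol_alpha_det n l_gt0).
  exact: cyclic_pol.
apply: (hwspace_multiplicity (P := polyMat R[i] n) (p := pol l_gt0)) => //.
- by move=> i j t; apply: pol_E.
(* The last factor of a is kappa, so the image of rho consists of K-invariant tensors. *)
- move=> _ /memv_imgP[t _ ->]; apply: pol_inj => s sK.
  have cK := @tactL_comp R[i] n l.
  by rewrite -tactLE /rho /a (actA_amul cK); apply: (act_actA_asum cK).
- by move=> i j _ /memv_imgP[t _ ->]; rewrite -rhoE memv_img ?memvf.
Qed.
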